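(* There is a computable function $f$ such that \textsc{Densest $k$-Subgraph} and \textsc{Sparsest $k$-Subgraph} can each be solved in time $f(\mathrm{nd}(G))\,n^{O(1)}$, where $G$ is the input graph, $n=|V(G)|$, and $\mathrm{nd}(G)$ is the neighborhood diversity of $G$.
   Context: All graphs are finite, simple and undirected. \textsc{Densest $k$-Subgraph}: given a graph $G=(V,E)$ and an integer $k$, find $S\subseteq V$ with $|S|=k$ maximizing the number of edges of the induced subgraph $G[S]$. \textsc{Sparsest $k$-Subgraph}: the same but minimizing the number of edges of $G[S]$. Two vertices $u,v$ are twins if $N(u)\setminus\{v\}=N(v)\setminus\{u\}$, where $N(x)$ is the set of neighbors of $x$. The neighborhood diversity $\mathrm{nd}(G)$ is the minimum number $d$ such that $V$ can be partitioned into $d$ sets, each consisting of pairwise twin vertices. *)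

(* Defs.v *)
(* MathComp *)
From mathcomp Require Import all_boot.
Set Implicit Arguments.
Unset Strict Implicit.
Unset Printing Implicit Defensive.

Record sgraph (V : finType) := SGraph {
  adj :> rel V;
  adj_sym : symmetric adj;
  adj_irr : irreflexive adj
}.

Section Graphs.
Variables (V : finType) (G : sgraph V).

Definition nbhd (x : V) : {set V} := [set y | G x y].

Definition twins (u v : V) : bool := nbhd u :\ v == nbhd v :\ u.

Definition twin_partition (P : {set {set V}}) : bool :=
  partition P [set: V] &&
  [forall B in P, [forall u in B, [forall v in B, twins u v]]].

Lemma twin_partition_ex :
  exists d, [exists P, twin_partition P && (#|P| == d)].
Proof.
pose P := [set [set x] | x : V].
exists #|P|; apply/existsP; exists P; rewrite eqxx andbT.
apply/andP; split.
  apply/and3P; split.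
  - apply/eqP/setP=> x; rewrite inE; apply/bigcupP; exists [set x].
      exact: imset_f.
    by rewrite inE.
  - apply/trivIsetP=> _ _ /imsetP[x _ ->] /imsetP[y _ ->] neq_xy.
    rewrite disjoints1 inE; apply: contraNN neq_xy => /eqP->; exact: eqxx.
  - by apply/imsetP=> -[x _ /setP/(_ x)]; rewrite !inE eqxx.
apply/forall_inP=> _ /imsetP[x _ ->].
apply/forall_inP=> u /set1P->; apply/forall_inP=> v /set1P->.
exact: eqxx.
Qed.

Definition nd : nat := ex_minn twin_partition_ex.

Definition induced_edges (S : {set V}) : {set {set V}} :=
  [set e | [exists u in S, [exists v in S, G u v && (e == [set u; v])]]].

Definition densest_k_subgraph (k : nat) (S : {set V}) : Prop :=
  #|S| = k /\
  forall S' : {set V}, #|S'| = k -> #|induced_edges S'| <= #|induced_edges S|.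

Definition sparsest_k_subgraph (k : nat) (S : {set V}) : Prop :=
  #|S| = k /\
  forall S' : {set V}, #|S'| = k -> #|induced_edges S| <= #|induced_edges S'|.

End Graphs.

(* The machine model is the random access machine with unit cost and with
   addition and truncated subtraction as its only arithmetic operations, so
   that each step lengthens the largest number in the machine by at most one
   bit (apart from the constants of the program): its running times agree with those of Turing machines up
   to a polynomial.  Programs use structured control instead of jumps. *)
Inductive cmd :=
| Skip
| Const (r c : nat)   (* r <- c *)
| Add (r a b : nat)   (* r <- a + b *)
| Sub (r a b : nat)   (* r <- a - b *)
| Read (r a : nat)    (* r <- mem[a] *)
| Write (a r : nat)   (* mem[a] <- r *)
| Seq (p q : cmd)
| If (r : nat) (p q : cmd)
| While (r : nat) (p : cmd).

Record state := State { reg : nat -> nat; mem : nat -> nat }.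

Definition set_reg (s : state) (r v : nat) : state :=
  State (fun i => if i == r then v else reg s i) (mem s).

Definition set_mem (s : state) (a v : nat) : state :=
  State (reg s) (fun i => if i == a then v else mem s i).

(* [exec p s t s'] : started in s, the program p halts in s' after exactly t
   steps, a step being an elementary instruction or a test.  Tests compare a
   register with 0. *)
Inductive exec : cmd -> state -> nat -> state -> Prop :=
| ExecSkip s : exec Skip s 1 s
| ExecConst s r c : exec (Const r c) s 1 (set_reg s r c)
| ExecAdd s r a b : exec (Add r a b) s 1 (set_reg s r (reg s a + reg s b))
| ExecSub s r a b : exec (Sub r a b) s 1 (set_reg s r (reg s a - reg s b))
| ExecRead s r a : exec (Read r a) s 1 (set_reg s r (mem s (reg s a)))
| ExecWrite s a r : exec (Write a r) s 1 (set_mem s (reg s a) (reg s r))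
| ExecSeq p q s1 s2 s3 t u :
    exec p s1 t s2 -> exec q s2 u s3 -> exec (Seq p q) s1 (t + u) s3
| ExecIfT r p q s t s' :
    reg s r != 0 -> exec p s t s' -> exec (If r p q) s t.+1 s'
| ExecIfF r p q s t s' :
    reg s r = 0 -> exec q s t s' -> exec (If r p q) s t.+1 s'
| ExecWhileT r p s1 s2 s3 t u :
    reg s1 r != 0 -> exec p s1 t s2 -> exec (While r p) s2 u s3 ->
    exec (While r p) s1 (t + u).+1 s3
| ExecWhileF r p s : reg s r = 0 -> exec (While r p) s 1 s.

Lemma exec_det p s t1 s1 t2 s2 :
  exec p s t1 s1 -> exec p s t2 s2 -> t1 = t2 /\ s1 = s2.
Proof.
move=> e1; elim: e1 t2 s2 => {p s t1 s1}.
- by move=> s t2 s2 e; inversion e.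
- by move=> s r c t2 s2 e; inversion e.
- by move=> s r a b t2 s2 e; inversion e.
- by move=> s r a b t2 s2 e; inversion e.
- by move=> s r a t2 s2 e; inversion e.
- by move=> s a r t2 s2 e; inversion e.
- move=> p q s1 s2 s3 t u _ IHp _ IHq t2 s4 e; inversion e; subst.
  match goal with H : exec p _ _ _ |- _ => case: (IHp _ _ H) => ??; subst end.
  by match goal with H : exec q _ _ _ |- _ => case: (IHq _ _ H) => ??; subst end.
- move=> r p q s t s' nz _ IH t2 s2 e; inversion e; subst; last first.
    by move: nz; match goal with H : reg _ _ = 0 |- _ => rewrite H end.
  by match goal with H : exec p _ _ _ |- _ => case: (IH _ _ H) => ??; subst end.
- move=> r p q s t s' z _ IH t2 s2 e; inversion e; subst.
    by match goal with H : is_true (_ != 0) |- _ => rewrite z in H end.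
  by match goal with H : exec q _ _ _ |- _ => case: (IH _ _ H) => ??; subst end.
- move=> r p s1 s2 s3 t u nz _ IHp _ IHw t2 s4 e; inversion e; subst; last first.
    by move: nz; match goal with H : reg _ _ = 0 |- _ => rewrite H end.
  match goal with H : exec p _ _ _ |- _ => case: (IHp _ _ H) => ??; subst end.
  by match goal with H : exec (While _ _) _ _ _ |- _ =>
    case: (IHw _ _ H) => ??; subst end.
- move=> r p s z t2 s2 e; inversion e; subst => //.
  by match goal with H : is_true (_ != 0) |- _ => rewrite z in H end.
Qed.

Definition computable (f : nat -> nat) : Prop :=
  exists p : cmd, forall d : nat, exists t s',
    exec p (State (fun r => if r == 0 then d else 0) (fun=> 0)) t s' /\
    reg s' 0 = f d.

(* Register 0 holds n, register 1 holds k, and memory starts with the adjacency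
   matrix of G, row by row; everything else is 0. *)
Definition input (n : nat) (G : sgraph 'I_n) (k : nat) : state :=
  State (fun r => if r == 0 then n else if r == 1 then k else 0)
        (fun a => [exists u : 'I_n, [exists v : 'I_n,
                     (a == u * n + v) && G u v]] : nat).

(* Either register 0 holds 1 and the first n memory cells hold the
   characteristic vector of a solution, or register 0 holds 0 and there is no
   solution (for k-subgraph problems, k > n). *)
Definition correct_output (n : nat) (sol : {set 'I_n} -> Prop) (s : state) :=
  (reg s 0 = 1 /\
     exists2 S : {set 'I_n}, sol S & forall v : 'I_n, mem s v = (v \in S)) \/
  (reg s 0 = 0 /\ forall S : {set 'I_n}, ~ sol S).

(* [maxn 1 n] is n except for the graph without vertices, where n ^ c would
   allow no step at all. *)
Definition solvable_in_fpt_nd_time (f : nat -> nat)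
    (problem : forall V : finType, sgraph V -> nat -> {set V} -> Prop) : Prop :=
  exists (p : cmd) (c : nat), forall (n : nat) (G : sgraph 'I_n) (k : nat),
    exists t s', [/\ exec p (input G k) t s',
      t <= f (nd G) * maxn 1 n ^ c &
      correct_output (problem _ G k) s'].

(* Main.v *)
Require Import Defs.
From mathcomp Require Import all_boot.
From mathcomp Require Import zify.
(* Gives the name [mem] back to the memory of the machine. *)
Import Defs.

(* Minimising the edges of a k-subset in G is maximising them in the complement
   of G, which has the same twins, so consider Densest k-Subgraph.  Among the
   optimal sets take one S with the most pairs of twins.  If the twin classes of
   u and v both meet S without being contained in it, consider moving one vertex
   from the class of u to that of v, or the other way round: the two changes in
   the number of edges have a nonnegative sum if u and v are not adjacent, and
   both moves together create pairs of twins, so one of them would improve S.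
   Hence u and v are adjacent.  Call a class full, empty or free according to
   its trace on S.  Since non-twin free vertices are adjacent, an exchange
   argument shows that starting from the full classes and repeatedly adding a
   free vertex with the most neighbours in the current set is optimal.  The
   machine tries the 3^d labellings of the d twin classes, writing each as a
   base-3 number.

   The algorithm is written in a language with arithmetic expressions, bounded
   sums and bounded loops, which is compiled to the machine; the running time is
   then a polynomial in the largest loop bound, which is max(n, 3^d). *)

Set Implicit Arguments.
Unset Strict Implicit.
Unset Printing Implicit Defensive.

(** * Greedy completion of an optimal labelling *)

Section Weight.
Variables (V : finType) (w : V -> V -> nat).
Hypothesis w_sym : forall x y, w x y = w y x.

Definition wdeg (S : {set V}) (x : V) := \sum_(y in S) w x y.
(** Ordered pairs are summed, so two distinct vertices count twice and the diagonal once. *)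
Definition weight (S : {set V}) := \sum_(x in S) wdeg S x.

Lemma wdegU1 (S : {set V}) b x : b \notin S -> wdeg (b |: S) x = w x b + wdeg S x.
Proof. by move=> bS; rewrite /wdeg big_setU1. Qed.

Lemma weightU1 (S : {set V}) b :
  b \notin S -> weight (b |: S) = weight S + (wdeg S b).*2 + w b b.
Proof.
move=> bS; rewrite /weight big_setU1 //= wdegU1 //.
under eq_bigr => x _ do rewrite wdegU1 // w_sym.
by rewrite big_split /= -/(wdeg S b); lia.
Qed.

(** Removing [a] and adding [b] are two uses of [weightU1], written without subtraction. The term
    [(w a b).*2] corrects for [wdeg S b] still counting [a]. *)
Lemma weight_swap (S : {set V}) a b : a \in S -> b \notin S ->
  weight (b |: S :\ a) + (wdeg S a).*2 + (w a b).*2 =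
  weight S + w a a + (wdeg S b).*2 + w b b.
Proof.
move=> aS bS; have bT : b \notin S :\ a by rewrite !inE negb_and bS orbT.
have aT : a \notin S :\ a by rewrite !inE eqxx.
have [] := (weightU1 aT, weightU1 bT); rewrite setD1K // => -> ->.
have [] := (wdegU1 a aT, wdegU1 b aT); rewrite setD1K // => -> ->.
by rewrite (w_sym b a); lia.
Qed.
End Weight.

Lemma card_swap (V : finType) (S : {set V}) a b :
  a \in S -> b \notin S -> #|b |: S :\ a| = #|S|.
Proof.
move=> aS bS; rewrite cardsU1 [in RHS](cardsD1 a) aS !inE.
by rewrite (negPf bS) andbF.
Qed.

(** * Twins, labels and the exchange arguments *)

Section Greedy.
Variables (V : finType) (H : rel V) (tw : rel V).
Hypotheses (H_sym : symmetric H) (H_irr : irreflexive H).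
Hypothesis tw_equiv : equivalence_rel tw.
Hypothesis twH : forall x y z, tw x y -> z != x -> z != y -> H x z = H y z.

Let tw_refl x : tw x x. Proof. by have [] := tw_equiv x x x. Qed.
Let tw_left x y z : tw x y -> tw x z = tw y z.
Proof. by have [_] := tw_equiv x y z. Qed.
Let tw_sym x y : tw x y = tw y x.
Proof. by apply/idP/idP=> /tw_left <-; rewrite tw_refl. Qed.

Definition degree := wdeg (fun x y => H x y : nat).
Definition arcs := weight (fun x y => H x y : nat).

Let arcs_swap (S : {set V}) a b : a \in S -> b \notin S ->
  arcs (b |: S :\ a) + (degree S a).*2 + (H a b).*2 = arcs S + (degree S b).*2.
Proof.
move=> aS bS; rewrite weight_swap // => [|x y]; last by rewrite H_sym.
by rewrite !H_irr !addn0.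
Qed.

(** For large [M], maximising this weight is lexicographic: first the arcs, then the pairs of
    twins. *)
Let tw_weight M x y := M * H x y + tw x y.

Let weight_tw M S : weight (tw_weight M) S =
  M * arcs S + weight (fun x y => tw x y : nat) S.
Proof.
rewrite /weight /wdeg big_distrr -big_split; apply: eq_bigr => x _ /=.
by rewrite big_distrr -big_split.
Qed.

(** The endpoints are replaced one at a time; as they lie in different classes, they stay distinct,
    which [twH] requires. *)
Let twH2 u a v b : tw u a -> tw v b -> ~~ tw u v -> H u v = H a b.
Proof.
move=> ua vb uv; have ub : ~~ tw u b by rewrite tw_sym -(tw_left _ vb) tw_sym.
have av : ~~ tw a v by rewrite -(tw_left _ ua).
have ab : ~~ tw a b by rewrite -(tw_left _ ua).
rewrite (twH ua); last 2 first.
- by apply: contraNneq uv => ->.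
- by apply: contraNneq av => ->.
rewrite !(H_sym a) (twH vb) //.
- by apply: contraNneq av => ->.
- by apply: contraNneq ab => ->.
Qed.

(* Moving one vertex between the twin classes of [a] and [b], in either
   direction, cannot increase the weight; the sum of the two changes is
   twice [w a a' + w b b' - 2 w a b]. *)
Let interior_adjacent M (S : {set V}) a a' b b' :
  (forall S' : {set V}, #|S'| = #|S| ->
     weight (tw_weight M) S' <= weight (tw_weight M) S) ->
  a \in S -> a' \notin S -> tw a a' -> b \in S -> b' \notin S -> tw b b' ->
  ~~ tw a b -> H a b.
Proof.
move=> maxS aS a'S aa' bS b'S bb' ab; set w := tw_weight M in maxS.
have w_sym x y : w x y = w y x by rewrite /w /tw_weight H_sym tw_sym.
have wxx x : w x x = 1 by rewrite /w /tw_weight H_irr tw_refl muln0.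
have w_tw x y : tw x y -> 0 < w x y by rewrite /w /tw_weight => ->; lia.
(* Twins see the rest of [S] alike, so the two sums differ only in the term at [x]; the 1 is
   [w x x]. *)
have wdeg_tw x y : tw x y -> x \in S -> y \notin S ->
    wdeg w S y + 1 = wdeg w S x + w x y.
  move=> xy xS yS; rewrite /wdeg !(bigD1 x xS) /= wxx w_sym.
  suff -> : \sum_(i in S | i != x) w y i = \sum_(i in S | i != x) w x i.
    by move: (\sum_(i in S | i != x) w x i) (w x y) => *; lia.
  apply: eq_bigr => z /andP[zS zx]; rewrite /w /tw_weight -(tw_left _ xy).
  by rewrite (twH xy) //; apply: contraNneq yS => <-.
have := maxS _ (card_swap aS b'S); have := maxS _ (card_swap bS a'S).
have := weight_swap w_sym aS b'S; have := weight_swap w_sym bS a'S.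
have := wdeg_tw _ _ aa' aS a'S; have := wdeg_tw _ _ bb' bS b'S.
rewrite !wxx; have := w_tw _ _ aa'; have := w_tw _ _ bb'.
have -> : w a b' = M * H a b.
  by rewrite /w /tw_weight (twH2 (tw_refl a) bb' ab) tw_sym -(tw_left _ bb')
    tw_sym (negPf ab) addn0.
have -> : w b a' = M * H a b.
  rewrite w_sym /w /tw_weight (twH2 aa' (tw_refl b) ab) -(tw_left _ aa').
  by rewrite (negPf ab) addn0.
(* Without the edge [a b] the cross terms vanish while [w a a'] and [w b b'] are positive, so one of
   the two moves would gain weight. *)
by case: (H a b) => //; lia.
Qed.

(** Label 1 is a full class, 0 an empty one and 2 a free one. The two tests exclude each other
    because the class of [v] contains [v]. *)
Definition label (S : {set V}) (v : V) : nat :=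
  if [forall u, tw v u ==> (u \in S)] then 1
  else if [forall u, tw v u ==> (u \notin S)] then 0 else 2.

Lemma label_tw S u v : tw u v -> label S u = label S v.
Proof.
move=> uv; rewrite /label.
have tw_all (P : pred V) : [forall x, tw u x ==> P x] = [forall x, tw v x ==> P x].
  by apply: eq_forallb => x; rewrite (tw_left _ uv).
by rewrite !tw_all.
Qed.

Lemma label_lt3 S v : label S v < 3.
Proof. by rewrite /label; case: ifP => _ //; case: ifP. Qed.

Definition candidate (l : V -> nat) (T : {set V}) (v : V) :=
  (l v == 2) && (v \notin T).

Definition best_candidate (l : V -> nat) (T : {set V}) (v : V) :=
  candidate l T v && [forall u, candidate l T u ==> (degree T u <= degree T v)].

Lemma best_candidate_exists l T u :
  candidate l T u -> exists v, best_candidate l T v.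
Proof.
move=> cu; case: (arg_maxnP (degree T) cu) => v cv vmax; exists v.
by rewrite /best_candidate cv; apply/forall_inP => x; apply: vmax.
Qed.

Definition optimal k (S : {set V}) :=
  #|S| = k /\ forall S' : {set V}, #|S'| = k -> arcs S' <= arcs S.

(* [T] extends to an optimal set by free vertices only. *)
Definition extendable k (l : V -> nat) (T : {set V}) :=
  exists2 S, optimal k S & T \subset S /\ forall v, v \in S -> v \notin T -> l v = 2.

(** If [v] is missing from the optimal extension [S], it replaces some [u] of [S :\: T] without loss
    of arcs: a twin of [v] if there is one, otherwise an arbitrary vertex. *)
Lemma greedy_step k (l : V -> nat) (T : {set V}) v :
  (forall x y, l x = 2 -> l y = 2 -> ~~ tw x y -> H x y) ->
  (forall x y, tw x y -> l x = l y) ->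
  extendable k l T -> best_candidate l T v -> #|T| < k ->
  extendable k l (v |: T).
Proof.
move=> l_adj l_tw [S [cS maxS] [TS lS]] /andP[/andP[/eqP lv vT] vmax] Tk.
have [vS|vS] := boolP (v \in S).
  exists S => //; split; first by rewrite subUset sub1set vS.
  by move=> x xS; rewrite !inE negb_or => /andP[_]; apply: lS.
suff [u [uS uT le_arcs]] : exists u, [/\ u \in S, u \notin T &
    arcs S <= arcs (v |: S :\ u)].
  exists (v |: S :\ u).
    split; first by rewrite card_swap.
    by move=> S' cS'; apply: leq_trans le_arcs; apply: maxS.
  split.
    by rewrite setUS // subsetD1 TS.
  move=> x; rewrite !inE => /orP[->//|/andP[_ xS]].
  by rewrite negb_or => /andP[_]; apply: lS.
have [R0|[r]] := set_0Vmem (S :\: T).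
  by have := cardsID T S; rewrite R0 (setIidPr TS) cards0 cS; lia.
rewrite !inE => /andP[rT rS].
have degS x : degree S x = degree T x + degree (S :\: T) x.
  by rewrite /degree /wdeg (big_setID T) /= (setIidPr TS).
have [/existsP[u /and3P[uS uT uv]]|/existsPn no_tw] :=
  boolP [exists u, [&& u \in S, u \notin T & tw u v]].
- exists u; split => //; have := arcs_swap uS vS.
  suff -> : degree S v = degree S u + H u v by lia.
  rewrite /degree /wdeg !(bigD1 u uS) /= H_irr H_sym add0n addnC; congr (_ + _).
  apply: eq_bigr => z /andP[zS zu]; rewrite -(twH uv) //.
  by apply: contraNneq vS => <-.
(* All of [S :\: T] is free and not twin to [v], hence adjacent to [v]. So [v] has more neighbours
   there than [r], which pays for the lost edge [r v]; towards [T] the greedy choice makes [v] at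
   least as good as [r]. *)
- have adj_v x : x \in S :\: T -> H x v.
    rewrite !inE => /andP[xT xS]; apply: l_adj (lS x xS xT) lv _.
    by have := no_tw x; rewrite xS xT.
  exists r; split => //; have := arcs_swap rS vS.
  have rR : r \in S :\: T by rewrite !inE rT.
  rewrite !degS (adj_v r rR).
  have -> : degree (S :\: T) v = #|S :\: T|.
    by rewrite /degree /wdeg -sum1_card; apply: eq_bigr => x /adj_v;
       rewrite H_sym => ->.
  have : degree (S :\: T) r < #|S :\: T|.
    rewrite /degree /wdeg (bigD1 r rR) /= H_irr (cardsD1 r) rR ltnS.
    rewrite -sum1_card [leqRHS](eq_bigl (fun x => (x \in S :\: T) && (x != r))).
      by apply: leq_sum => x _; case: (H r x).
    by move=> x; rewrite in_setD1 andbC.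
  have : degree T r <= degree T v.
    apply: (implyP (forallP vmax r)); rewrite /candidate rT.
    by rewrite lS.
  by move: (degree _ _) (degree _ _) (degree _ _) (arcs _) (arcs _) => *; lia.
Qed.

Lemma greedy_start k : k <= #|V| -> exists S : {set V}, [/\ optimal k S,
  forall x y, label S x = 2 -> label S y = 2 -> ~~ tw x y -> H x y &
  extendable k (label S) [set v | label S v == 1]].
Proof.
(* A [k]-set has at most [k ^ 2] ordered pairs of twins, so with this [M] one more arc outweighs any
   gain in twins. *)
move=> kV; pose M := (k ^ 2).+1; pose w := tw_weight M.
have [S0 cS0] : exists S0 : {set V}, #|S0| == k.
  have : 0 < #|[set S : {set V} | #|S| == k]| by rewrite card_draws bin_gt0.
  by case/card_gt0P => S; rewrite inE; exists S.
case: (arg_maxnP (P := fun S : {set V} => #|S| == k) (weight w) cS0) => S /eqP cS maxS.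
have optS : optimal k S.
  split=> // S' cS'; have /eqP/maxS := cS'; rewrite !weight_tw.
  have : weight (fun x y => tw x y : nat) S < M.
    rewrite ltnS -mulnn -{1}cS -sum_nat_const; apply: leq_sum => x _.
    by rewrite -cS -sum1_card; apply: leq_sum => y _; case: (tw x y).
  move: (weight _ S) (weight _ S') => x y lt_xM le_xy; rewrite leqNgt.
  by apply/negP => lt_SS'; have := leq_mul (leqnn M) lt_SS'; rewrite mulnS; lia.
exists S; split => //.
- have lab2 x : label S x = 2 -> exists a a', [/\ a \in S, a' \notin S, tw x a & tw x a'].
    rewrite /label; case: ifPn => // /forallPn[a']; rewrite negb_imply => /andP[xa' a'S].
    case: ifPn => // /forallPn[a]; rewrite negb_imply negbK => /andP[xa aS] _.
    by exists a, a'.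
  move=> x y /lab2[a [a' [aS a'S xa xa']]] /lab2[b [b' [bS b'S yb yb']]] xy.
  rewrite (twH2 xa yb xy); apply: (interior_adjacent (M := M) (S := S) (a' := a')
    (b' := b')) => //.
  + by move=> S' cS'; apply: maxS; rewrite cS' cS.
  + by rewrite -(tw_left _ xa).
  + by rewrite -(tw_left _ yb).
  + by rewrite -(tw_left _ xa) tw_sym -(tw_left _ yb) tw_sym.
- exists S => //; split.
    apply/subsetP => v; rewrite inE /label; case: ifPn => [/forallP/(_ v)|_].
      by rewrite tw_refl.
    by case: ifP.
  move=> v vS; rewrite inE /label; case: ifP => // _ _; case: ifP => // /forallP/(_ v).
  by rewrite tw_refl vS.
Qed.
End Greedy.

(** * A loop language and its compilation *)

Definition upd (f : nat -> nat) (x v : nat) : nat -> nat :=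
  fun y => if y == x then v else f y.

Inductive expr :=
| Num (c : nat)
| Var (x : nat)
| Plus (a b : expr)
| Minus (a b : expr)
| Deref (a : expr)
| Ite (c a b : expr)
| Sum (x b : nat) (e : expr).

Fixpoint eval (m env : nat -> nat) (e : expr) : nat :=
  match e with
  | Num c => c
  | Var x => env x
  | Plus a b => eval m env a + eval m env b
  | Minus a b => eval m env a - eval m env b
  | Deref a => m (eval m env a)
  | Ite c a b => if eval m env c != 0 then eval m env a else eval m env b
  | Sum x b e => \sum_(i < env b) eval m (upd env x i) e
  end.

Inductive stmt :=
| Assign (x : nat) (e : expr)
| Store (a e : expr)
| Then (p q : stmt)
| When (e : expr) (p : stmt)
| For (x b : nat) (p : stmt).

(** A loop leaves its index at the bound, as the compiled code does by counting [x] up to [b]. *)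
Fixpoint run (p : stmt) (s : state) : state :=
  match p with
  | Assign x e => set_reg s x (eval (mem s) (reg s) e)
  | Store a e => set_mem s (eval (mem s) (reg s) a) (eval (mem s) (reg s) e)
  | Then p q => run q (run p s)
  | When e p => if eval (mem s) (reg s) e != 0 then run p s else s
  | For x b p =>
      set_reg (iteri (reg s b) (fun i s => run p (set_reg s x i)) s) x (reg s b)
  end.

(* Source variables are the registers below [nvars]; the compiled code uses
   the registers from [nvars] on as a stack of temporaries. *)
Definition nvars := 20.

(* [loc] is the register holding each variable, which differs from the
   variable itself for the index of a [Sum]. *)
Fixpoint comp_expr (loc : nat -> nat) (r : nat) (e : expr) : cmd :=
  match e with
  | Num c => Const r c
  | Var x => Seq (Const r 0) (Add r (loc x) r)
  | Plus a b => Seq (comp_expr loc r a) (Seq (comp_expr loc r.+1 b) (Add r r r.+1))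
  | Minus a b => Seq (comp_expr loc r a) (Seq (comp_expr loc r.+1 b) (Sub r r r.+1))
  | Deref a => Seq (comp_expr loc r a) (Read r r)
  | Ite c a b => Seq (comp_expr loc r c) (If r (comp_expr loc r a) (comp_expr loc r b))
  | Sum x b e =>
      Seq (Const r 0) (Seq (Const r.+1 0) (Seq (Sub r.+2 (loc b) r.+1)
        (While r.+2
          (Seq (comp_expr (upd loc x r.+1) r.+2 e)
          (Seq (Add r r r.+2) (Seq (Const r.+2 1) (Seq (Add r.+1 r.+1 r.+2)
               (Sub r.+2 (loc b) r.+1))))))))
  end.

Fixpoint comp (p : stmt) : cmd :=
  match p with
  | Assign x e =>
      Seq (comp_expr id nvars e) (Seq (Const nvars.+1 0) (Add x nvars nvars.+1))
  | Store a e =>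
      Seq (comp_expr id nvars a) (Seq (comp_expr id nvars.+1 e) (Write nvars nvars.+1))
  | Then p q => Seq (comp p) (comp q)
  | When e p => Seq (comp_expr id nvars e) (If nvars (comp p) Skip)
  | For x b p =>
      Seq (Const x 0) (Seq (Sub nvars b x)
        (While nvars (Seq (comp p)
          (Seq (Const nvars 1) (Seq (Add x x nvars) (Sub nvars b x))))))
  end.

(** The index of a sum lies outside [D], so binding it cannot change a loop bound. *)
Fixpoint wf_expr (D : seq nat) (e : expr) : bool :=
  match e with
  | Num c => true
  | Var x => x < nvars
  | Plus a b => wf_expr D a && wf_expr D b
  | Minus a b => wf_expr D a && wf_expr D b
  | Deref a => wf_expr D a
  | Ite c a b => [&& wf_expr D c, wf_expr D a & wf_expr D b]
  | Sum x b e => [&& x < nvars, x \notin D, b < nvars, b \in D & wf_expr D e]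
  end.

(* [D] lists the registers that may bound a loop and [L] the indices of the
   enclosing loops; neither may be assigned. *)
Fixpoint wf (D L : seq nat) (p : stmt) : bool :=
  match p with
  | Assign x e => [&& x < nvars, x \notin D, x \notin L & wf_expr D e]
  | Store a e => wf_expr D a && wf_expr D e
  | Then p q => wf D L p && wf D L q
  | When e p => wf_expr D e && wf D L p
  | For x b p =>
      [&& x < nvars, x \notin D, x \notin L, b < nvars, b \in D & wf D (x :: L) p]
  end.

(** Here [M] stands for an upper bound on all loop bounds; a conditional is charged for both
    branches. *)
Fixpoint cost_expr (M : nat) (e : expr) : nat :=
  match e with
  | Num _ => 1
  | Var _ => 2
  | Plus a b => cost_expr M a + cost_expr M b + 1
  | Minus a b => cost_expr M a + cost_expr M b + 1
  | Deref a => cost_expr M a + 1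
  | Ite c a b => cost_expr M c + cost_expr M a + cost_expr M b + 1
  | Sum _ _ e => M * (cost_expr M e + 5) + 4
  end.

Fixpoint cost (M : nat) (p : stmt) : nat :=
  match p with
  | Assign _ e => cost_expr M e + 2
  | Store a e => cost_expr M a + cost_expr M e + 1
  | Then p q => cost M p + cost M q
  | When e p => cost_expr M e + cost M p + 2
  | For _ _ p => M * (cost M p + 4) + 3
  end.

(** With [M] positive, raising the exponent never lowers the bound. *)
Definition poly_bounded (f : nat -> nat) :=
  exists K c, forall M, 0 < M -> f M <= K * M ^ c.

Lemma poly_const k : poly_bounded (fun=> k).
Proof. by exists k, 0 => M _; rewrite muln1. Qed.

Lemma poly_id : poly_bounded id.
Proof. by exists 1, 1 => M _; rewrite mul1n. Qed.

Lemma poly_add f g :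
  poly_bounded f -> poly_bounded g -> poly_bounded (fun M => f M + g M).
Proof.
move=> [K [c fP]] [K' [c' gP]]; exists (K + K'), (c + c') => M M0.
rewrite mulnDl; apply: leq_add.
  by apply: leq_trans (fP M M0) _; rewrite leq_mul // leq_pexp2l // leq_addr.
by apply: leq_trans (gP M M0) _; rewrite leq_mul // leq_pexp2l // leq_addl.
Qed.

Lemma poly_mul f g :
  poly_bounded f -> poly_bounded g -> poly_bounded (fun M => f M * g M).
Proof.
move=> [K [c fP]] [K' [c' gP]]; exists (K * K'), (c + c') => M M0.
by rewrite expnD mulnACA leq_mul ?fP ?gP.
Qed.

Ltac poly := repeat first
  [ assumption | apply: poly_id | apply: poly_const | apply: poly_add | apply: poly_mul ].

Lemma poly_cost_expr e : poly_bounded (cost_expr^~ e).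
Proof. by elim: e => *; rewrite /=; poly. Qed.

Lemma poly_cost p : poly_bounded (cost^~ p).
Proof.
by elim: p => *; rewrite /=;
  repeat first [apply: poly_cost_expr | progress poly].
Qed.

(** * Correctness of compiled expressions *)

Lemma eval_ext m m' env env' e D : wf_expr D e ->
  (forall a, m a = m' a) -> (forall x, x < nvars -> env x = env' x) ->
  eval m env e = eval m' env' e.
Proof.
move=> + eq_m; elim: e env env' => //=.
- by move=> x env env' xn; apply.
- by move=> a IHa b IHb env env' /andP[wa wb] E; rewrite (IHa _ env') // (IHb _ env').
- by move=> a IHa b IHb env env' /andP[wa wb] E; rewrite (IHa _ env') // (IHb _ env').
- by move=> a IHa env env' wa E; rewrite (IHa _ env').
- move=> c IHc a IHa b IHb env env' /and3P[wc wa wb] E.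
  by rewrite (IHc _ env') // (IHa _ env') // (IHb _ env').
- move=> x b e IH env env' /and5P[_ _ bn _ we] E; rewrite E //.
  by apply: eq_bigr => i _; apply: IH => // y yn; rewrite /upd E.
Qed.

Ltac step := first [ apply: ExecConst | apply: ExecAdd | apply: ExecSub
  | apply: ExecRead | apply: ExecWrite | apply: ExecSkip ].

(** Preserving the registers below [r] lets an operator evaluate its second argument at [r.+1]
    without losing the first. The environment is separate from the registers because the index of a
    sum lives in a temporary. *)
Definition correct M (D : seq nat) e := forall loc r env s,
  (forall x, x < nvars -> loc x < r /\ reg s (loc x) = env x) ->
  (forall b, b \in D -> env b <= M) ->
  exists t s', [/\ exec (comp_expr loc r e) s t s', t <= cost_expr M e,
    reg s' r = eval (mem s) env e, mem s' = mem s &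
    forall i, i < r -> reg s' i = reg s i].

Lemma comp_exprP D M e : wf_expr D e -> correct M D e.
Proof.
have lt_neq i r : i < r -> (i == r) = false by move=> *; apply/eqP; lia.
have bin (op : nat -> nat -> nat) (c : nat -> nat -> nat -> cmd) a b :
    (forall s x y z, exec (c x y z) s 1 (set_reg s x (op (reg s y) (reg s z)))) ->
    correct M D a ->
    correct M D b ->
    forall loc r env s,
      (forall x, x < nvars -> loc x < r /\ reg s (loc x) = env x) ->
      (forall b, b \in D -> env b <= M) ->
      exists t s', [/\
        exec (Seq (comp_expr loc r a) (Seq (comp_expr loc r.+1 b) (c r r r.+1))) s t s',
        t <= cost_expr M a + cost_expr M b + 1,
        reg s' r = op (eval (mem s) env a) (eval (mem s) env b), mem s' = mem s &
        forall i, i < r -> reg s' i = reg s i].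
  move=> execc IHa IHb loc r env s E DM.
  have [ta [sa [xa lea va ma fa]]] := IHa _ _ _ _ E DM.
  have [|tb [sb [xb leb vb mb fb]]] := IHb loc r.+1 env sa _ DM.
    by move=> x xn; have [lx <-] := E x xn; rewrite fa //; split => //; lia.
  exists (ta + (tb + 1)), (set_reg sb r (op (reg sb r) (reg sb r.+1))).
  split => //=.
  - by apply: ExecSeq xa _; apply: ExecSeq xb _; apply: execc.
  - lia.
  - by rewrite eqxx fb // va vb ma.
  - by rewrite mb.
  - by move=> i ir; rewrite lt_neq // fb ?fa //; lia.
elim: e => /=.
- move=> c _ loc r env s E _ /=; exists 1, (set_reg s r c); split => //=.
  + exact: ExecConst.
  + by rewrite eqxx.
  + by move=> i ir; rewrite lt_neq.
- move=> x xn loc r env s E _ /=; have [lx vx] := E x xn.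
  exists (1 + 1); eexists; split.
  + by apply: ExecSeq; step.
  + by [].
  + by rewrite /= !eqxx lt_neq // addn0.
  + by [].
  + by move=> i ir /=; rewrite lt_neq.
- by move=> a IHa b IHb /andP[wa wb]; apply: (bin addn Add) (IHa wa) (IHb wb) => *; step.
- by move=> a IHa b IHb /andP[wa wb]; apply: (bin subn Sub) (IHa wa) (IHb wb) => *; step.
- move=> a IHa wa loc r env s E DM /=; have [t [s' [xa lea va ma fa]]] := IHa wa _ _ _ _ E DM.
  exists (t + 1); eexists; split.
  + by apply: ExecSeq xa _; step.
  + by rewrite leq_add2r.
  + by rewrite /= eqxx va ma.
  + by [].
  + by move=> i ir /=; rewrite lt_neq // fa.
- move=> c IHc a IHa b IHb /and3P[wc wa wb] loc r env s E DM /=.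
  have [tc [sc [xc lec vc mc fc]]] := IHc wc _ _ _ _ E DM.
  have E' x : x < nvars -> loc x < r /\ reg sc (loc x) = env x.
    by move=> xn; have [lx <-] := E x xn; rewrite fc.
  case: ifPn => [nz|/negPn/eqP z].
  + have [t [s' [xa lea va ma fa]]] := IHa wa _ _ _ _ E' DM.
    exists (tc + t.+1), s'; split.
    * by apply: ExecSeq xc _; apply: ExecIfT => //; rewrite vc.
    * lia.
    * by rewrite va mc.
    * by rewrite ma.
    * by move=> i ir; rewrite fa ?fc.
  + have [t [s' [xb leb vb mb fb]]] := IHb wb _ _ _ _ E' DM.
    exists (tc + t.+1), s'; split.
    * by apply: ExecSeq xc _; apply: ExecIfF => //; rewrite vc.
    * lia.
    * by rewrite vb mc.
    * by rewrite mb.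
    * by move=> i ir; rewrite fb ?fc.
- move=> x b e IH /and5P[xn xD bn bD we] loc r env s E DM /=.
  have [lb vb] := E b bn.
  set W := While _ _.
  (* [i] iterations are done and [n] remain: [r] holds the partial sum, [r.+1] the index and [r.+2]
     the difference that the loop tests. *)
  have loop n : forall i s1, i + n = env b ->
      mem s1 = mem s -> (forall j, j < r -> reg s1 j = reg s j) ->
      reg s1 r = \sum_(j < i) eval (mem s) (upd env x j) e ->
      reg s1 r.+1 = i -> reg s1 r.+2 = n ->
      exists t s', [/\ exec W s1 t s', t <= n * (cost_expr M e + 5) + 1,
        reg s' r = \sum_(j < env b) eval (mem s) (upd env x j) e, mem s' = mem s &
        forall i, i < r -> reg s' i = reg s i].
    elim: n => [|n IHn] i s1 ib m1 f1 v1 i1 n1.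
      exists 1, s1; split => //; first exact: ExecWhileF.
      by rewrite v1 -ib addn0.
    have [||t [s2 [x2 le2 v2 m2 f2]]] := IH we (upd loc x r.+1) r.+2 (upd env x i) s1.
    + move=> y yn; rewrite /upd; case: eqP => _; first by rewrite i1.
      by have [ly <-] := E y yn; rewrite f1 //; split=> //; lia.
    + move=> y yD; rewrite /upd; case: eqP => [yx|_]; last exact: DM.
      by rewrite -yx yD in xD.
    pose s3 := set_reg s2 r (reg s2 r + reg s2 r.+2).
    pose s4 := set_reg s3 r.+2 1.
    pose s5 := set_reg s4 r.+1 (reg s4 r.+1 + reg s4 r.+2).
    pose s6 := set_reg s5 r.+2 (reg s5 (loc b) - reg s5 r.+1).
    have e1 : (r.+2 == r.+1) = false by apply/eqP; lia.
    have e2 : (r.+1 == r) = false by apply/eqP; lia.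
    have e3 : (r.+2 == r) = false by apply/eqP; lia.
    have e4 : (r == r.+1) = false by apply/eqP; lia.
    have e5 : (r == r.+2) = false by apply/eqP; lia.
    have e6 : (r.+1 == r.+2) = false by apply/eqP; lia.
    have e7 : (loc b == r.+2) = false by apply/eqP; lia.
    have e8 : (loc b == r.+1) = false by apply/eqP; lia.
    have e9 : (loc b == r) = false by apply/eqP; lia.
    have eE := (e1, e2, e3, e4, e5, e6, e7, e8, e9, eqxx).
    have [||||||t' [s' [x' le' v' m' f']]] := IHn i.+1 s6.
    + by lia.
    + by rewrite /= m2.
    + move=> j jr; rewrite /=.
      have -> : (j == r.+2) = false by apply/eqP; lia.
      have -> : (j == r.+1) = false by apply/eqP; lia.
      by rewrite lt_neq // f2 ?f1 //; lia.
    + by rewrite /= !eE /= big_ord_recr /= v2 f2 ?v1 ?m1.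
    + by rewrite /= !eE /= f2 ?i1 ?addn1.
    + by rewrite /= !eE /= !f2 ?i1 ?(f1 (loc b)) ?vb //; lia.
    exists ((t + (1 + (1 + (1 + 1)))) + t').+1, s'; split => //.
    + apply: ExecWhileT x'; first by rewrite n1.
      by do 4![apply: ExecSeq; first by [exact: x2 | step]]; step.
    + by lia.
  have [||||||t [s' [xl lel vl ml fl]]] := loop (env b) 0
    (set_reg (set_reg (set_reg s r 0) r.+1 0) r.+2 (env b)).
  + by [].
  + by [].
  + move=> j jr /=; have -> : (j == r.+2) = false by apply/eqP; lia.
    have -> : (j == r.+1) = false by apply/eqP; lia.
    by rewrite lt_neq.
  + have -> : (reg (set_reg (set_reg (set_reg s r 0) r.+1 0) r.+2 (env b)) r) = 0.
      rewrite /=; have -> : (r == r.+2) = false by apply/eqP; lia.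
      have -> : (r == r.+1) = false by apply/eqP; lia.
      by rewrite eqxx.
    by rewrite big_ord0.
  + rewrite /=; have -> : (r.+1 == r.+2) = false by apply/eqP; lia.
    by rewrite eqxx.
  + by rewrite /= eqxx.
  exists (1 + (1 + (1 + t))), s'; split => //.
  + apply: ExecSeq; first by step.
    apply: ExecSeq; first by step.
    apply: ExecSeq xl.
    have -> : env b = reg (set_reg (set_reg s r 0) r.+1 0) (loc b) -
                    reg (set_reg (set_reg s r 0) r.+1 0) r.+1.
      rewrite /= eqxx; have -> : (loc b == r.+1) = false by apply/eqP; lia.
      by rewrite lt_neq // vb subn0.
    by step.
  + have := leq_mul (DM _ bD) (leqnn (cost_expr M e + 5)); lia.
Qed.

(** * Correctness of compiled statements *)

Definition agree (s s' : state) :=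
  (forall x, x < nvars -> reg s' x = reg s x) /\ (forall a, mem s' a = mem s a).

(** All starting states that agree with [s] are allowed, so fragments compose although each leaves
    arbitrary values in the temporaries. *)
Definition realizes (c : cmd) (s : state) (T : nat) (s' : state) :=
  forall s1, agree s s1 ->
    exists t s1', [/\ exec c s1 t s1', t <= T & agree s' s1'].

Lemma realizes_seq c1 c2 s1 s2 s3 T1 T2 :
  realizes c1 s1 T1 s2 -> realizes c2 s2 T2 s3 ->
  realizes (Seq c1 c2) s1 (T1 + T2) s3.
Proof.
move=> r1 r2 s /r1[t [s' [x le_t /r2[u [s'' [y le_u ag]]]]]].
by exists (t + u), s''; split=> //; [apply: ExecSeq x y | apply: leq_add].
Qed.

(** Well-formed code assigns neither loop bounds nor enclosing indices. Hence bounds stay below [M]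
    during a run, and a loop finds its index intact after its body. *)
Lemma run_frame D L p s y :
  wf D L p -> (y \in D) || (y \in L) -> reg (run p s) y = reg s y.
Proof.
elim: p L s => /= [x e|a e|p IHp q IHq|e p IHp|x b p IHp] L s.
- move=> /and4P[_ xD xL _] yDL; case: eqP => // yx.
  by rewrite yx (negPf xD) (negPf xL) in yDL.
- by [].
- by move=> /andP[wp wq] yDL; rewrite (IHq _ _ wq) // (IHp _ _ wp).
- by move=> /andP[_ wp] yDL; case: ifP => // _; rewrite (IHp _ _ wp).
- move=> /and5P[_ xD xL _ /andP[_ wp]] yDL; case: eqP => [yx|/eqP yx].
    by rewrite yx (negPf xD) (negPf xL) in yDL.
  elim: (reg s b) => //= n <-; rewrite (IHp _ _ wp) /= ?(negPf yx) //.
  by case/orP: yDL => [->//|yL]; rewrite inE yL !orbT.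
Qed.

Lemma comp_expr_agree D M e r s s1 : wf_expr D e -> nvars <= r -> agree s s1 ->
  (forall b, b \in D -> reg s b <= M) ->
  exists t s1', [/\ exec (comp_expr id r e) s1 t s1', t <= cost_expr M e,
    reg s1' r = eval (mem s) (reg s) e, agree s s1' &
    forall i, i < r -> reg s1' i = reg s1 i].
Proof.
move=> we nr [sr sm] sD.
have [x xn|t [s' [xe le_t v mE f]]] := comp_exprP we (loc := id) (r := r) (s := s1) _ sD.
  by rewrite sr //; split => //; lia.
exists t, s'; split => //.
- by rewrite v; apply: eval_ext we _ _.
- by split=> [x xn|a]; rewrite ?mE // f ?sr //; lia.
Qed.

Lemma compP D L M p s : wf D L p ->
  (forall b, b \in D -> reg s b <= M) -> realizes (comp p) s (cost M p) (run p s).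
Proof.
have ltn0 i : i < nvars -> (i == nvars) = false by move=> *; apply/eqP; lia.
have ltn1 i : i < nvars -> (i == nvars.+1) = false by move=> *; apply/eqP; lia.
elim: p L s => /= [x e|a e|p IHp q IHq|e p IHp|x b p IHp] L s.
- move=> /and4P[xn _ _ we] sD s1 ag.
  have [t [s' [xe le_t v [fr fm] _]]] := comp_expr_agree we (leqnn _) ag sD.
  exists (t + (1 + 1)); eexists; split.
  + by apply: ExecSeq xe _; apply: ExecSeq; step.
  + by rewrite leq_add2r.
  + split=> [y yn|y] /=; last exact: fm.
    rewrite ltn1 //; case: ifP => _; last exact: fr.
    by rewrite v addn0.
- move=> /andP[wa we] sD s1 ag.
  have [t [s' [xa le_t va ag' _]]] := comp_expr_agree wa (leqnn _) ag sD.
  have [u [s'' [xe le_u ve [fr fm] f]]] := comp_expr_agree we (leqnSn _) ag' sD.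
  exists (t + (u + 1)); eexists; split.
  + by apply: ExecSeq xa _; apply: ExecSeq xe _; step.
  + by rewrite addnA leq_add2r leq_add.
  + by split=> [y yn|y] /=; [apply: fr | rewrite f // va ve fm].
- move=> /andP[wp wq] sD; apply: realizes_seq; first exact: (IHp _ _ wp).
  by apply: (IHq _ _ wq) => b bD; rewrite (run_frame _ wp) ?bD // sD.
- move=> /andP[we wp] sD s1 ag.
  have [t [s' [xe le_t v ag' _]]] := comp_expr_agree we (leqnn _) ag sD.
  case: ifPn => [nz|/negPn/eqP z].
  + have [u [s'' [xp le_u ag'']]] := IHp _ _ wp sD _ ag'.
    exists (t + u.+1), s''; split=> //; last by lia.
    by apply: ExecSeq xe _; apply: ExecIfT => //; rewrite v.
  + exists (t + 2), s'; split=> //; last by lia.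
    by apply: ExecSeq xe _; apply: ExecIfF; [rewrite v | step].
- move=> /and5P[xn xD xL bn /andP[bD wp]] sD.
  have bx : (b == x) = false by apply: contraNF xD => /eqP <-.
  set W := While _ _.
  pose st i := iteri i (fun i s => run p (set_reg s x i)) s.
  have stD i y : y \in D -> reg (st i) y = reg s y.
    move=> yD; elim: i => //= i <-; rewrite (run_frame _ wp) ?yD //=.
    by case: eqP => // yx; rewrite yx (negPf xD) in yD.
  have loop n : forall i s1, i + n = reg s b ->
      agree (set_reg (st i) x i) s1 -> reg s1 nvars = n ->
      exists t s', [/\ exec W s1 t s', t <= n * (cost M p + 4) + 1 &
        agree (set_reg (st (reg s b)) x (reg s b)) s'].
    elim: n => [|n IHn] i s1 ib ag n1.
      rewrite addn0 in ib; exists 1, s1; split=> //; first exact: ExecWhileF.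
      by rewrite -ib.
    have [|t [s2 [xp le_t [fr fm]]]] := IHp _ (set_reg (st i) x i) wp _ _ ag.
      move=> y yD /=; case: eqP => [yx|_]; first by rewrite yx (negPf xD) in yD.
      by rewrite stD // sD.
    (* The source sets the index afresh in each round, the compiled code increments it; both agree
       because the body does not touch it. *)
    have s2x : reg s2 x = i by rewrite fr // (run_frame _ wp) ?inE ?eqxx ?orbT //= eqxx.
    have s2b : reg s2 b = reg s b.
      by rewrite fr // (run_frame _ wp) ?bD //= bx stD.
    pose s3 := set_reg s2 nvars 1.
    pose s4 := set_reg s3 x (reg s3 x + reg s3 nvars).
    pose s5 := set_reg s4 nvars (reg s4 b - reg s4 x).
    have [|||u [s' [xW le_u ag']]] := IHn i.+1 s5.
    + by lia.
    + split=> [y yn|y] /=; last by rewrite fm.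
      rewrite !ltn0 //; case: eqP => _; first by rewrite s2x addn1.
      by rewrite fr.
    + rewrite /= !ltn0 // eqxx bx s2x s2b; lia.
    exists ((t + (1 + (1 + 1))) + u).+1, s'; split=> //.
    + apply: ExecWhileT xW; first by rewrite n1.
      by do 3![apply: ExecSeq; first by [exact: xp | step]]; step.
    + by lia.
  move=> s1 [fr fm].
  have [|||t [s' [xW le_t ag]]] :=
    loop (reg s b) 0 (set_reg (set_reg s1 x 0) nvars (reg s b)).
  + by [].
  + split=> [y yn|y] /=; last exact: fm.
    by rewrite ltn0 //; case: eqP => // _; rewrite fr.
  + by [].
  exists (1 + (1 + t)), s'; split=> //.
  + apply: ExecSeq; first by step.
    apply: ExecSeq xW.
    have -> : reg s b = reg (set_reg s1 x 0) b - reg (set_reg s1 x 0) x.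
      by rewrite /= eqxx bx fr // subn0.
    by step.
  + have := leq_mul (sD _ bD) (leqnn (cost M p + 4)); lia.
Qed.

(** * Twins and induced edges *)

Section Graph.
Variables (V : finType) (G : sgraph V).

Lemma twinsP u v :
  reflect (forall z, z != u -> z != v -> G u z = G v z) (twins G u v).
Proof.
apply: (iffP eqP) => [/setP E z /negPf zu /negPf zv|E].
  by have := E z; rewrite !inE zu zv.
apply/setP => z; rewrite !inE.
case: eqVneq => [->|zv]; first by rewrite adj_irr andbF.
by case: eqVneq => [->|zu]; rewrite ?adj_irr ?E.
Qed.

Lemma twins_sym u v : twins G u v = twins G v u.
Proof. by rewrite /twins eq_sym. Qed.

Lemma twins_equiv : equivalence_rel (twins G).
Proof.
have refl x : twins G x x by rewrite /twins.
have trans x y z : twins G x y -> twins G y z -> twins G x z.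
  move=> /twinsP xy /twinsP yz; apply/twinsP => t tx tz.
  have [ty|ty] := eqVneq t y; last by rewrite xy // yz.
  (* At [t = y] neither hypothesis applies directly; the equality passes through the pair [x z],
     seen once from [y] and once from the other end. *)
  rewrite {t}ty in tx tz *; have [->//|xz] := eqVneq x z.
  have yxz : G y x = G z x by apply: yz => //; rewrite eq_sym.
  have xyz : G x z = G y z by apply: xy; rewrite eq_sym.
  by rewrite (adj_sym G x y) yxz (adj_sym G z x) xyz adj_sym.
move=> x y z; split=> // xy; apply/idP/idP; apply: trans => //.
by rewrite twins_sym.
Qed.

Definition arc (co : bool) (u v : V) := if co then (u != v) && ~~ G u v else G u v.

Lemma arc_sym co : symmetric (arc co).
Proof. by move=> u v; rewrite /arc eq_sym adj_sym. Qed.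

Lemma arc_irr co : irreflexive (arc co).
Proof. by move=> u; rewrite /arc eqxx adj_irr; case: co. Qed.

Lemma arc_twins co x y z : twins G x y -> z != x -> z != y -> arc co x z = arc co y z.
Proof.
move=> /twinsP xy zx zy; rewrite /arc xy //.
by rewrite eq_sym zx eq_sym zy.
Qed.

(** Each block of a minimum twin partition consists of twins, so it contains at most one vertex of
    [T]. *)
Lemma card_nontwins_le_nd (T : {set V}) :
  {in T &, forall u v, twins G u v -> u = v} -> #|T| <= nd G.
Proof.
move=> T_inj; rewrite /nd; case: ex_minnP => d /existsP[P /andP[/andP[partP twP] /eqP <-]] _.
have [/eqP cP _ _] := and3P partP.
have P_cover v : v \in cover P by rewrite cP.
rewrite -(card_in_imset (f := pblock P)) => [|u v uT vT uv].
  by apply: subset_leq_card; apply/subsetP => _ /imsetP[v _ ->]; apply: pblock_mem.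
apply: T_inj => //; have vB : v \in pblock P v by rewrite mem_pblock.
have /forall_inP/(_ _ (pblock_mem (P_cover u)))/forall_inP/(_ u) := twP.
by rewrite mem_pblock => /(_ (P_cover u))/forall_inP/(_ v); apply; rewrite uv.
Qed.

Lemma arcs_adj S : arcs (arc false) S = (#|induced_edges G S|).*2.
Proof.
pose A := [set p : V * V | [&& p.1 \in S, p.2 \in S & G p.1 p.2]].
have -> : arcs (arc false) S = #|A|.
  rewrite /arcs /weight /wdeg pair_big_dep /= -sum1_card [LHS](big_mkcond) [RHS]big_mkcond /=.
  apply: eq_bigr => -[u v] _; rewrite inE /=.
  by case: (u \in S); case: (v \in S); case: (G u v).
pose f (p : V * V) := [set p.1; p.2].
have fA : {in A, forall p, f p \in induced_edges G S}.
  move=> [u v]; rewrite !inE /= => /and3P[uS vS uv].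
  by apply/exists_inP; exists u => //; apply/exists_inP; exists v => //; rewrite uv /=.
(* Ordered pairs are grouped by the edge they span; each group is the two orientations of one
   edge. *)
rewrite -sum1_card (partition_big f (fun e => e \in induced_edges G S)) //=.
rewrite -muln2 -sum_nat_const; apply: eq_bigr => e; rewrite inE.
move=> /exists_inP[u uS /exists_inP[v vS /andP[uv /eqP ->]]].
rewrite sum1dep_card (_ : [set p | _] = [set (u, v); (v, u)]).
  rewrite cards2 xpair_eqE; case: eqVneq uv => //= ->.
  by rewrite adj_irr.
apply/setP => -[x y]; rewrite !inE !xpair_eqE /f /=; apply/andP/orP.
  move=> [/and3P[xS yS xy] /eqP/setP E].
  have := E x; have := E y; rewrite !inE !eqxx orbT /=.
  by move=> /esym/orP[]/eqP yE /esym/orP[]/eqP xE; move: xy;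
     rewrite xE yE ?adj_irr ?eqxx //; auto.
by case=> /andP[/eqP-> /eqP->]; rewrite ?uS ?vS ?uv ?(adj_sym G v u) ?uv // setUC.
Qed.

(** An ordered pair from [S] is an arc of the complement, an arc of [G] or diagonal. For fixed size,
    minimising one arc count thus maximises the other. *)
Lemma arcs_co S : arcs (arc true) S + arcs (arc false) S + #|S| = #|S| * #|S|.
Proof.
rewrite -sum_nat_const -big_split -sum1_card -big_split; apply: eq_bigr => u uS /=.
rewrite /wdeg -big_split (bigD1 u) //= [RHS](bigD1 u) //=.
rewrite /arc eqxx adj_irr /= addnC; congr (_ + _).
by apply: eq_bigr => v /andP[_ vu]; rewrite eq_sym vu; case: (G u v).
Qed.
End Graph.

(** * The algorithm *)

Definition Not e := Ite e (Num 0) (Num 1).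
Definition And a b := Ite a b (Num 0).
Definition Lt a b := Ite (Minus b a) (Num 1) (Num 0).
Definition Eq a b := Not (Plus (Minus a b) (Minus b a)).

Lemma eval_Not m env e (P : bool) :
  eval m env e = P -> eval m env (Not e) = ~~ P.
Proof. by rewrite /= => ->; case: P. Qed.

Lemma eval_Not_eq0 m env e : eval m env (Not e) = (eval m env e == 0).
Proof. by rewrite /=; case: eval. Qed.

Lemma eval_And m env a b (P Q : bool) : eval m env a = P -> eval m env b = Q ->
  eval m env (And a b) = P && Q.
Proof. by rewrite /= => -> ->; case: P. Qed.

Lemma eval_Lt m env a b :
  eval m env (Lt a b) = (eval m env a < eval m env b).
Proof. by rewrite /= subn_eq0 -ltnNge; case: ltnP. Qed.

Lemma eval_Eq m env a b :
  eval m env (Eq a b) = (eval m env a == eval m env b).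
Proof. by rewrite /= addn_eq0 !subn_eq0 -eqn_leq; case: eqP. Qed.

Lemma eval_Sum m env x b e :
  eval m env (Sum x b e) = \sum_(i < env b) eval m (upd env x i) e.
Proof. by []. Qed.

(** The machine does not multiply: [Sum 9 0 r] adds up [n] copies of [r], using 9 as index. *)
Definition Cell (r x : expr) := Deref (Plus (Sum 9 0 r) x).
Definition Adj x y := Cell (Var x) (Var y).
Definition Row c x := Cell (Plus (Var 0) (Num c)) (Var x).
Definition StoreRow c x e :=
  Store (Plus (Sum 9 0 (Plus (Var 0) (Num c))) (Var x)) e.

Lemma eval_Row m env c x :
  eval m env (Row c x) = m (env 0 * (env 0 + c) + env x).
Proof. by rewrite /= sum_nat_const card_ord. Qed.

Lemma eval_Adj m env x y : x != 9 ->
  eval m env (Adj x y) = m (env 0 * env x + env y).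
Proof. by move=> /negPf x9; rewrite /= /upd x9 sum_nat_const card_ord. Qed.

Lemma run_StoreRow c x e s : run (StoreRow c x e) s =
  set_mem s (reg s 0 * (reg s 0 + c) + reg s x) (eval (mem s) (reg s) e).
Proof. by rewrite /= sum_nat_const card_ord. Qed.

Lemma sum_ltn a b : b <= a -> \sum_(i < a) (i < b) = b.
Proof.
elim: a b => [|a IH] b; first by rewrite leqn0 big_ord0 => /eqP->.
rewrite leq_eqVlt ltnS big_ord_recr /= => /orP[/eqP->|ba].
  rewrite ltnSn (eq_bigr (fun=> 1)) => [|i _]; last by rewrite ltnS ltnW.
  by rewrite sum_nat_const card_ord muln1 addn1.
by rewrite IH // ltnNge ba addn0.
Qed.

(* The least value of variable 11 below [n] that satisfies [p], or [n]. *)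
Definition First p :=
  Sum 12 0 (Not (Sum 11 0 (And (Not (Lt (Var 12) (Var 11))) p))).

Variant first_spec n (P : pred 'I_n) : nat -> Prop :=
| FirstSome (v : 'I_n) of P v & (forall u : 'I_n, u < v -> ~~ P u) : first_spec P v
| FirstNone of (forall v, ~~ P v) : first_spec P n.

Lemma eval_First n (P : pred 'I_n) m env p : env 0 = n ->
  (forall (i : 'I_n) t, eval m (upd (upd env 12 t) 11 i) p = P i) ->
  first_spec P (eval m env (First p)).
Proof.
move=> n0 pP.
(* Each [t] with no witness up to [t] contributes 1, and the number of such [t] is the least
   witness, or [n]. *)
have -> : eval m env (First p) =
    \sum_(t < n) [forall i : 'I_n, (i <= t) ==> ~~ P i].
  rewrite eval_Sum n0; apply: eq_bigr => t _.
  rewrite eval_Not_eq0; set e := Sum _ _ _; suff -> : eval m (upd env 12 t) e =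
      \sum_(i < n) ((i <= t) && P i).
    rewrite sum_nat_eq0; congr nat_of_bool; apply: eq_forallb => i /=.
    by rewrite eqb0 negb_and implybE.
  rewrite eval_Sum (_ : upd _ _ _ 0 = n) //; apply: eq_bigr => i _.
  by apply: eval_And; [rewrite leqNgt; apply: eval_Not; rewrite eval_Lt|apply: pP].
have [v0 Pv0|P0] := pickP P; last first.
  rewrite [X in first_spec _ X](_ : _ = n); first by apply: FirstNone => v; rewrite P0.
  rewrite -[RHS]card_ord -sum1_card; apply: eq_bigr => t _.
  by rewrite (_ : [forall i, _]) //; apply/forallP => i; rewrite P0 implybT.
case: (arg_minnP (fun v : 'I_n => v : nat) Pv0) => v Pv vmin.
rewrite [X in first_spec _ X](_ : _ = nat_of_ord v).
  by apply: FirstSome => // u uv; apply/negP => /vmin; rewrite leqNgt uv.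
transitivity (\sum_(t < n) (t < v)).
  apply: eq_bigr => t _; case: forallP => [/(_ v)|H].
    by rewrite Pv implybF -ltnNge => ->.
  case: ltnP => // tv; case: H => i; apply/implyP => it; apply/negP => /vmin.
  by lia.
by apply: sum_ltn; apply: ltnW.
Qed.

(* [co] tells whether the graph is the input graph or its complement.
   Names of the registers: 0 = n, 1 = k, 2 = number of labellings, 3 = the
   labelling being tried, 8 = one plus the best number of arcs found, or 0.
   Rows n, n+1, n+2 of the memory hold the labels, the current set and the
   best set. *)
Section Program.
Variable co : bool.

Definition Arc x y := if co then And (Not (Eq (Var x) (Var y))) (Not (Adj x y)) else Adj x y.

(** Relates the vertex in 4 to the one in 11, over which [First] searches; [First Twin] is thus the
    least twin of vertex 4. *)
Definition Twin :=
  Not (Sum 10 0 (And (And (Not (Eq (Var 10) (Var 11))) (Not (Eq (Var 10) (Var 4))))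
                     (Not (Eq (Adj 11 10) (Adj 4 10))))).

Definition Deg x := Sum 10 0 (And (Row 1 10) (Arc x 10)).
Definition Cand x := And (Eq (Row 0 x) (Num 2)) (Not (Row 1 x)).
Definition BestCand :=
  And (Cand 11) (Not (Sum 13 0 (And (Cand 13) (Lt (Deg 11) (Deg 13))))).
Definition Size := Sum 10 0 (Row 1 10).
Definition Arcs := Sum 14 0 (Sum 15 0 (And (And (Row 1 14) (Row 1 15)) (Arc 14 15))).
(** Counts the [i] with [3 * (i + 1)] at most the value of variable 5; variable 2 is a long enough
    range if that value does not exceed it. *)
Definition Div3 :=
  Sum 13 2 (Not (Lt (Var 5) (Plus (Plus (Var 13) (Var 13)) (Plus (Var 13) (Num 3))))).

(** Triples once per twin class, at the least vertex of the class. *)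
Definition count_labellings :=
  Then (Assign 2 (Num 1))
       (For 4 0 (When (Eq (First Twin) (Var 4))
                      (Assign 2 (Plus (Var 2) (Plus (Var 2) (Var 2)))))).

(** The least vertex of a class takes the next base-3 digit as its label; the later ones copy the
    label already stored for it. *)
Definition decode_body :=
  Then (Assign 6 (First Twin))
  (Then (When (Eq (Var 6) (Var 4))
    (Then (StoreRow 0 4 (Minus (Var 5) (Plus Div3 (Plus Div3 Div3))))
          (Assign 5 Div3)))
    (When (Lt (Var 6) (Var 4)) (StoreRow 0 4 (Row 0 6)))).
Definition decode := Then (Assign 5 (Var 3)) (For 4 0 decode_body).

Definition start := For 4 0 (StoreRow 1 4 (Eq (Row 0 4) (Num 1))).

Definition greedy_body :=
  Then (Assign 6 (First BestCand))
       (When (And (Lt (Var 6) (Var 0)) (Lt Size (Var 1))) (StoreRow 1 6 (Num 1))).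
Definition greedy := For 7 0 greedy_body.

Definition record :=
  When (And (Eq Size (Var 1)) (Lt (Var 8) (Plus Arcs (Num 1))))
       (Then (Assign 8 (Plus Arcs (Num 1)))
             (For 4 0 (StoreRow 2 4 (Row 1 4)))).

Definition attempt := Then decode (Then start greedy).
Definition search := For 3 2 (Then attempt record).
Definition output := For 4 0 (Store (Var 4) (Row 2 4)).
Definition verdict := Assign 0 (Lt (Num 0) (Var 8)).

(** The pieces are compiled separately because registers 0 and 2 bound loops in some pieces and are
    assigned in others. *)
Definition program :=
  Seq (comp count_labellings) (Seq (comp search) (Seq (comp output) (comp verdict))).

(** Registers 1 and 8 are not loop indices; listing them lets [run_frame] show that they survive. *)
Lemma wf_count : wf [:: 0] [:: 1; 8] count_labellings. Proof. by []. Qed.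
Lemma wf_attempt : wf [:: 0; 2] [:: 1; 3; 8] attempt. Proof. by rewrite /= /Arc; case: co. Qed.
Lemma wf_search : wf [:: 0; 2] [:: 1] search. Proof. by rewrite /= /Arc; case: co. Qed.
Lemma wf_output : wf [:: 0] [:: 1; 8] output. Proof. by []. Qed.
Lemma wf_verdict : wf [::] [::] verdict. Proof. by []. Qed.

(** * Meaning of the expressions of the program *)

Section Correctness.
Variables (n k : nat) (G : sgraph 'I_n).

Local Notation edge := (arc G co).

Definition has_graph (m : nat -> nat) := forall u v : 'I_n, m (n * u + v) = G u v.
Definition has_row c (m : nat -> nat) (f : 'I_n -> nat) :=
  forall v : 'I_n, m (n * (n + c) + v) = f v.
Definition has_set c m (T : {set 'I_n}) := has_row c m (fun v => v \in T).

Lemma eval_Arc m env x y (u v : 'I_n) : has_graph m -> env 0 = n -> x != 9 ->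
  env x = u -> env y = v -> eval m env (Arc x y) = edge u v.
Proof.
move=> mG n0 x9 xu yv; have adjP : eval m env (Adj x y) = G u v.
  by rewrite eval_Adj // n0 xu yv mG.
rewrite /Arc /arc; case: co => //; apply: eval_And; apply: eval_Not => //.
by rewrite eval_Eq /= xu yv.
Qed.

Lemma eval_has_row c m f env x (v : 'I_n) : has_row c m f -> env 0 = n ->
  env x = v -> eval m env (Row c x) = f v.
Proof. by move=> mf n0 xv; rewrite eval_Row n0 xv mf. Qed.

Lemma eval_Twin m env (u v : 'I_n) : has_graph m -> env 0 = n ->
  env 11 = u -> env 4 = v -> eval m env Twin = twins G u v.
Proof.
move=> mG n0 xu yv; have -> : twins G u v =
    [forall z : 'I_n, ~~ [&& z != u, z != v & G u z != G v z]].
  apply/eqP/forallP => [/setP E z|E].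
    by have := E z; rewrite !inE; case: (z == u) => //; case: (z == v) => //= ->; rewrite eqxx.
  apply/setP => z; have := E z; rewrite !inE.
  case: (z =P u) => [->|_] /=; first by rewrite adj_irr andbF.
  case: (z =P v) => [->|_] /=; first by rewrite adj_irr.
  by rewrite negbK => /eqP.
rewrite /Twin eval_Not_eq0; set e := Sum 10 0 _.
rewrite (_ : eval m env e = \sum_(z < n) [&& z != u, z != v & G u z != G v z]).
  by rewrite sum_nat_eq0; congr nat_of_bool; apply: eq_forallb => z; rewrite eqb0.
rewrite /e eval_Sum n0; apply: eq_bigr => z _; rewrite andbA.
apply: eval_And.
  by apply: eval_And; apply: eval_Not; rewrite eval_Eq /= /upd /= ?xu ?yv.
apply: eval_Not; rewrite eval_Eq !eval_Adj // /upd /= n0 xu yv !mG.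
by case: (G u z); case: (G v z).
Qed.

Lemma eval_Deg m env T x (u : 'I_n) : has_graph m -> has_set 1 m T ->
  env 0 = n -> x != 9 -> x != 10 -> env x = u ->
  eval m env (Deg x) = degree edge T u.
Proof.
move=> mG mT n0 x9 /negPf x10 xu; rewrite /degree /wdeg big_mkcond eval_Sum n0.
apply: eq_bigr => v _; rewrite (eval_And (P := v \in T) (Q := edge u v)).
- by case: (v \in T).
- by rewrite (eval_has_row (v := v) mT) /upd.
- by apply: eval_Arc; rewrite /upd ?x10.
Qed.

Lemma eval_Cand m env l T x (u : 'I_n) : has_row 0 m l -> has_set 1 m T ->
  env 0 = n -> env x = u -> eval m env (Cand x) = candidate l T u.
Proof.
move=> ml mT n0 xu; apply: eval_And.
  by rewrite eval_Eq (eval_has_row (v := u) ml).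
by apply: eval_Not; rewrite (eval_has_row (v := u) mT).
Qed.

Lemma eval_BestCand m env l T (u : 'I_n) : has_graph m -> has_row 0 m l ->
  has_set 1 m T -> env 0 = n -> env 11 = u ->
  eval m env BestCand = best_candidate edge l T u.
Proof.
move=> mG ml mT n0 xu; apply: eval_And; first exact: eval_Cand.
set e := Sum _ _ _.
rewrite eval_Not_eq0.
rewrite (_ : eval m env e =
    \sum_(v < n) (candidate l T v && (degree edge T u < degree edge T v))).
  rewrite sum_nat_eq0; congr nat_of_bool; apply: eq_forallb => v /=.
  by rewrite eqb0 negb_and -leqNgt implybE.
rewrite /e eval_Sum n0; apply: eq_bigr => v _; apply: eval_And; first exact: eval_Cand.
by rewrite eval_Lt (eval_Deg (u := u) mG mT) // (eval_Deg (u := v) mG mT).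
Qed.

Lemma eval_Size m env T : has_set 1 m T -> env 0 = n -> eval m env Size = #|T|.
Proof.
move=> mT n0; rewrite -sum1_card big_mkcond eval_Sum n0; apply: eq_bigr => v _.
rewrite -/(Row 1 10) (eval_has_row (v := v) mT) //; by case: (v \in T).
Qed.

Lemma eval_Arcs m env T : has_graph m -> has_set 1 m T -> env 0 = n ->
  eval m env Arcs = arcs edge T.
Proof.
move=> mG mT n0; rewrite /arcs /weight big_mkcond eval_Sum n0.
apply: eq_bigr => u _; rewrite /wdeg big_mkcond eval_Sum (_ : upd _ _ _ 0 = n) //.
transitivity (\sum_(v < n) [&& u \in T, v \in T & edge u v]).
  apply: eq_bigr => v _; rewrite andbA; apply: eval_And.
    by apply: eval_And; [apply: (eval_has_row (v := u) mT)|apply: (eval_has_row (v := v) mT)].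
  by apply: eval_Arc.
case: (u \in T) => /=; last by rewrite big1.
by apply: eq_bigr => v _; case: (v \in T).
Qed.

Lemma eval_Div3 m env : env 5 <= env 2 -> eval m env Div3 = env 5 %/ 3.
Proof.
move=> le52; transitivity (\sum_(i < env 2) (i < env 5 %/ 3)).
  rewrite eval_Sum; apply: eq_bigr => i _.
  rewrite (eval_Not (P := env 5 < 3 * i + 3)); last first.
    by rewrite eval_Lt /= /upd /=; congr (nat_of_bool (_ < _)); lia.
  by rewrite -leqNgt leq_divRL //; congr (nat_of_bool (_ <= _)); lia.
by apply: sum_ltn; apply: leq_trans le52; apply: leq_div.
Qed.
End Correctness.
End Program.

(** * Correctness of the algorithm *)

Lemma iteri_ind T (Inv : nat -> T -> Prop) n (f : nat -> T -> T) x :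
  Inv 0 x -> (forall (i : 'I_n) y, Inv i y -> Inv i.+1 (f i y)) ->
  Inv n (iteri n f x).
Proof.
move=> x0 step; suff : forall m, m <= n -> Inv m (iteri m f x) by apply.
elim=> // m IH lt_mn; exact: (step (Ordinal lt_mn)) (IH (ltnW lt_mn)).
Qed.

Lemma addr_eq n r r' (v v' : 'I_n) :
  (n * r + v == n * r' + v') = (r == r') && (v == v').
Proof.
have n0 : 0 < n by apply: leq_ltn_trans (ltn_ord v).
apply/eqP/andP => [E|[/eqP-> /eqP->] //].
have := congr1 (divn^~ n) E; have := congr1 (modn^~ n) E.
rewrite ![n * _]mulnC !modnMDl !divnMDl // !modn_small // !divn_small // !addn0.
by move=> /val_inj-> ->.
Qed.

(* Number whose base-3 digits, the least significant one first, are the labels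
   of the elements of [s] that satisfy [rep]. *)
Definition code (T : Type) (rep : pred T) (l : T -> nat) (s : seq T) :=
  foldr (fun v c => if rep v then l v + 3 * c else c) 0 s.

Lemma code_lt (T : Type) (rep : pred T) l (s : seq T) : (forall v, l v < 3) ->
  code rep l s < 3 ^ count rep s.
Proof.
move=> l3; elim: s => //= v s; case: (rep v) => // IH; rewrite expnS.
by have := l3 v; move: IH; move: (code _ _ _) (3 ^ _) => *; lia.
Qed.

Lemma run_Assign x e s : run (Assign x e) s = set_reg s x (eval (mem s) (reg s) e).
Proof. by []. Qed.

Lemma run_Then p q s : run (Then p q) s = run q (run p s).
Proof. by []. Qed.

Lemma run_When e p s :
  run (When e p) s = if eval (mem s) (reg s) e != 0 then run p s else s.
Proof. by []. Qed.

Lemma run_ForP (Inv : nat -> state -> Prop) n x b p s : reg s b = n -> Inv 0 s ->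
  (forall (i : 'I_n) s', Inv i s' -> Inv i.+1 (run p (set_reg s' x i))) ->
  exists2 s', Inv n s' & run (For x b p) s = set_reg s' x n.
Proof. by move=> bn s0 step; eexists; last rewrite /= bn; last by []; apply: iteri_ind. Qed.

Lemma eval_Var m env x : eval m env (Var x) = env x. Proof. by []. Qed.
Lemma eval_Num m env c : eval m env (Num c) = c. Proof. by []. Qed.
Lemma eval_Plus m env a b : eval m env (Plus a b) = eval m env a + eval m env b.
Proof. by []. Qed.
Lemma eval_Minus m env a b : eval m env (Minus a b) = eval m env a - eval m env b.
Proof. by []. Qed.
Definition evalE := (eval_Var, eval_Num, eval_Plus, eval_Minus, eval_Eq, eval_Lt).

Lemma run_WhenP (P : bool) e p s : eval (mem s) (reg s) e = P ->
  run (When e p) s = if P then run p s else s.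
Proof. by rewrite run_When => ->; case: P. Qed.

Lemma mem_set_reg s x v : mem (set_reg s x v) = mem s. Proof. by []. Qed.

Arguments eval : simpl never.
Arguments run : simpl never.

(** * Effect of the statements of the program *)

Section Runs.
Variables (co : bool) (n k : nat) (G : sgraph 'I_n).
Local Notation edge := (arc G co).

(** Selects one vertex of each twin class, its least. *)
Definition is_rep (v : 'I_n) := [forall u : 'I_n, (u < v) ==> ~~ twins G u v].
Definition labellings := 3 ^ #|is_rep|.

Lemma labellingsE : labellings = 3 ^ count is_rep (enum 'I_n).
Proof. by rewrite /labellings -size_filter cardE enumT. Qed.

(** Frame condition on memory: the rows that may change start at [n], past the adjacency matrix. *)
Definition kept (C : seq nat) (s s' : state) :=
  forall r (v : 'I_n), r \notin [seq n + c | c <- C] -> mem s' (n * r + v) = mem s (n * r + v).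

Lemma kept_trans C s1 s2 s3 : kept C s1 s2 -> kept C s2 s3 -> kept C s1 s3.
Proof. by move=> k12 k23 r v rC; rewrite k23 ?k12. Qed.

Lemma kept_sub C C' s s' : {subset C <= C'} -> kept C s s' -> kept C' s s'.
Proof.
move=> sCC' ks r v rC'; apply: ks; apply: contra rC' => /mapP[c cC ->].
by apply: map_f; apply: sCC'.
Qed.

Lemma kept_graph C s s' : kept C s s' -> has_graph G (mem s) -> has_graph G (mem s').
Proof.
move=> ks sG u v; rewrite ks ?sG //; apply/mapP => -[c _ E].
by have := ltn_ord u; rewrite E; lia.
Qed.

Lemma kept_row C s s' c (f : 'I_n -> nat) : kept C s s' -> c \notin C ->
  has_row c (mem s) f -> has_row c (mem s') f.
Proof. by move=> ks cC sf v; rewrite ks ?sf // mem_map //; apply: addnI. Qed.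

Lemma kept_set_row C s c (v : 'I_n) x : c \in C -> kept C s (set_mem s (n * (n + c) + v) x).
Proof.
move=> cC r u rC /=; rewrite addr_eq; case: eqP => // E.
by rewrite E map_f in rC.
Qed.

Lemma eval_rep m env (v : 'I_n) : has_graph G m -> env 0 = n -> env 4 = v ->
  first_spec (fun u => twins G u v) (eval m env (First Twin)).
Proof.
move=> mG n0 v4; apply: eval_First => // i t.
by apply: eval_Twin.
Qed.

Lemma first_twinP m env (v : 'I_n) : has_graph G m -> env 0 = n -> env 4 = v ->
  exists u : 'I_n, [/\ eval m env (First Twin) = u, twins G u v, u <= v &
     is_rep v = (u == v)].
Proof.
move=> mG n0 v4; case: (eval_rep mG n0 v4) => [u uv umin|/(_ v)]; last by rewrite /twins eqxx.
have le_uv : u <= v by rewrite leqNgt; apply/negP => /umin; rewrite /twins eqxx.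
exists u; split=> //; apply/forall_inP/eqP => [vmin|uE]; last
  by move=> w wv; apply: umin; rewrite uE.
apply/eqP; rewrite -val_eqE eqn_leq le_uv /= leqNgt; apply/negP => /vmin.
by rewrite uv.
Qed.

Lemma run_count s : has_graph G (mem s) -> reg s 0 = n ->
  mem (run count_labellings s) = mem s /\ reg (run count_labellings s) 2 = labellings.
Proof.
move=> sG n0; rewrite run_Then run_Assign.
pose Inv i s' := [/\ mem s' = mem s, reg s' 0 = n &
    reg s' 2 = 3 ^ count is_rep (take i (enum 'I_n))].
have [||i s' [ms' n0' w]|s' [ms' n0' w] ->] :=
  run_ForP (Inv := Inv) (n := n) (x := 4) (b := 0)
  (p := When (Eq (First Twin) (Var 4)) (Assign 2 (Plus (Var 2) (Plus (Var 2) (Var 2)))))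
  (s := set_reg s 2 (eval (mem s) (reg s) (Num 1))).
- by [].
- by rewrite /Inv take0.
- rewrite /Inv (take_nth i) ?size_enum_ord // nth_ord_enum.
  rewrite -cats1 count_cat /= addn0.
  have [|||u [e _ _ r]] := @first_twinP (mem s') (reg (set_reg s' 4 i)) i; rewrite ?ms' //.
  rewrite (run_WhenP (P := u == i)); last by rewrite eval_Eq mem_set_reg e.
  rewrite -r expnD; case: (is_rep i); last by rewrite muln1.
  rewrite run_Assign; split=> //=. by rewrite !evalE /= w expn1 mulnC !mulSn mul0n addn0.
- split=> //=; rewrite w take_oversize ?size_enum_ord //.
  by rewrite labellingsE.
Qed.

(** The result is specified only for numbers that encode a labelling constant on twin classes, so
    [code] need not be inverted; the frame condition holds for every number tried. *)
Lemma run_decode s : has_graph G (mem s) -> reg s 0 = n -> reg s 2 = labellings ->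
  reg s 3 < labellings -> kept [:: 0] s (run decode s) /\
  forall l, (forall u v, twins G u v -> l u = l v) -> (forall v, l v < 3) ->
    reg s 3 = code is_rep l (enum 'I_n) -> has_row 0 (mem (run decode s)) l.
Proof.
move=> sG n0 w2 c3; rewrite run_Then run_Assign.
(* Register 5 holds the code of the vertices not yet visited; its bound is what [eval_Div3]
   requires. *)
pose Inv i s' := [/\ kept [:: 0] s s', reg s' 0 = n, reg s' 2 = labellings,
  reg s' 5 <= labellings &
  forall l, (forall u v, twins G u v -> l u = l v) -> (forall v, l v < 3) ->
    reg s 3 = code is_rep l (enum 'I_n) ->
    reg s' 5 = code is_rep l (drop i (enum 'I_n)) /\
    forall v : 'I_n, v < i -> mem s' (n * (n + 0) + v) = l v].
have [||i s' [ks n0' w2' le5 dec]|s' [ks _ _ _ dec] ->] :=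
  run_ForP (Inv := Inv) (n := n) (x := 4) (b := 0)
  (p := decode_body) (s := set_reg s 5 (eval (mem s) (reg s) (Var 3))).
- by [].
- split=> //; first exact: ltnW.
  by move=> l _ _ E; rewrite drop0.
- have s'G := kept_graph ks sG.
  have [|||u [e tw_ui le_ui r]] := @first_twinP (mem s') (reg (set_reg s' 4 i)) i => //.
  rewrite (drop_nth i) ?size_enum_ord // nth_ord_enum in dec.
  rewrite /decode_body 2!run_Then run_Assign mem_set_reg e.
  rewrite (run_WhenP (P := u == i) (e := Eq (Var 6) (Var 4))); last by rewrite eval_Eq.
  case: eqVneq => [ui|ui].
  + rewrite run_Then run_Assign run_StoreRow !evalE !eval_Div3 /= ?w2' //.
    rewrite n0' run_When eval_Lt /= ui ltnn /=; split=> //=.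
    * apply: kept_trans ks _; exact: kept_set_row.
    * by apply: leq_trans (leq_div _ _) _.
    * move=> l l_tw l3 E; have [E5 H] := dec l l_tw l3 E.
      move: E5; rewrite /= r ui eqxx => E5; have := l3 i; split; first by lia.
      move=> v; rewrite ltnS leq_eqVlt => /orP[/eqP/val_inj->|vi].
        by rewrite addr_eq !eqxx /=; lia.
      by rewrite addr_eq eqxx /= -val_eqE (ltn_eqF vi) H.
  + have lt_ui : u < i by rewrite ltn_neqAle le_ui andbT.
    rewrite (run_WhenP (P := true)); last by rewrite eval_Lt /= lt_ui.
    rewrite run_StoreRow eval_Row /= n0'; split=> //=.
    * apply: kept_trans ks _; exact: kept_set_row.
    * move=> l l_tw l3 E; have [E5 H] := dec l l_tw l3 E.
      move: E5; rewrite /= r (negPf ui) => E5; split=> // v.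
      rewrite ltnS leq_eqVlt => /orP[/eqP/val_inj->|vi].
        by rewrite addr_eq !eqxx /= H //; apply: l_tw.
      by rewrite addr_eq eqxx /= -val_eqE (ltn_eqF vi) H.
- split=> // l l_tw l3 /(dec _ l_tw l3)[_ H'] v; exact: H'.
Qed.

Lemma run_start s l : reg s 0 = n -> has_row 0 (mem s) l ->
  kept [:: 1] s (run start s) /\
  has_set 1 (mem (run start s)) [set v : 'I_n | l v == 1].
Proof.
move=> n0 sl; pose Inv i s' := [/\ kept [:: 1] s s', reg s' 0 = n &
  forall v : 'I_n, v < i -> mem s' (n * (n + 1) + v) = (l v == 1)].
have [||i s' [ks n0' row]|s' [ks n0' row] ->] :=
  run_ForP (Inv := Inv) (n := n) (x := 4) (b := 0)
  (p := StoreRow 1 4 (Eq (Row 0 4) (Num 1))) (s := s).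
- by [].
- by [].
- rewrite run_StoreRow eval_Eq mem_set_reg.
  rewrite (eval_has_row (v := i) (kept_row ks (c := 0) isT sl)) // evalE /= n0'.
  split=> //=.
    by apply: kept_trans ks _; apply: kept_set_row.
  move=> v; rewrite addr_eq eqxx ltnS leq_eqVlt val_eqE /=.
  by case: eqVneq => [->|_] //=; apply: row.
- by split=> // v; rewrite inE row.
Qed.

(** Any labelling leaves some set in row 1, which keeps the search sound; optimality is claimed only
    for labellings to which [greedy_step] applies. *)
Lemma run_greedy s l (T : {set 'I_n}) :
  has_graph G (mem s) -> reg s 0 = n -> reg s 1 = k ->
  has_row 0 (mem s) l -> has_set 1 (mem s) T ->
  kept [:: 1] s (run (greedy co) s) /\
  exists T' : {set 'I_n}, has_set 1 (mem (run (greedy co) s)) T' /\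
    ((forall x y, l x = 2 -> l y = 2 -> ~~ twins G x y -> edge x y) ->
     (forall x y, twins G x y -> l x = l y) ->
     extendable edge k l T -> optimal edge k T').
Proof.
move=> sG n0 k1 sl sT.
pose good := forall x y, l x = 2 -> l y = 2 -> ~~ twins G x y -> edge x y.
(* Each round adds a vertex until [k] are present, whence [minn i k]; [n] rounds suffice since a
   [k]-set exists. *)
pose Inv i s' := [/\ kept [:: 1] s s', reg s' 0 = n, reg s' 1 = k &
  exists T' : {set 'I_n}, has_set 1 (mem s') T' /\
    (good -> (forall x y, twins G x y -> l x = l y) ->
     extendable edge k l T -> extendable edge k l T' /\ minn i k <= #|T'|)].
have [||i s' [ks n0' k1' [T' [s'T' gT']]]|s' [ks n0' k1' [T' [s'T' gT']]] ->] :=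
  run_ForP (Inv := Inv) (n := n) (x := 7) (b := 0) (p := greedy_body co) (s := s).
- by [].
- split=> //; exists T; split=> // g_adj g_tw gT; split=> //; by rewrite min0n.
- have s'G := kept_graph ks sG; have s'l := kept_row ks (c := 0) isT sl.
  rewrite run_Then run_Assign.
  have : first_spec (best_candidate edge l T')
      (eval (mem (set_reg s' 7 i)) (reg (set_reg s' 7 i)) (First (BestCand co))).
    by apply: eval_First => // v t; apply: eval_BestCand.
  set b := eval _ _ _ => bP; have {bP} : first_spec (best_candidate edge l T') b by [].
  set s1 := set_reg _ 6 b => bP.
  have step (P := (b < n) && (#|T'| < k)) :
      run (When (And (Lt (Var 6) (Var 0)) (Lt Size (Var 1))) (StoreRow 1 6 (Num 1))) s1 =
      if P then set_mem s1 (n * (n + 1) + b) 1 else s1.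
    rewrite (run_WhenP (P := P)); first by rewrite run_StoreRow /= n0'.
    apply: eval_And; first by rewrite !evalE /= n0'.
    by rewrite eval_Lt (eval_Size (T := T') s'T') // evalE /= k1'.
  rewrite {}step; have [Tk|kT] := ltnP #|T'| k; last first.
    rewrite andbF; split=> //; exists T'; split=> // g1 g2 g3.
    by have [? _] := gT' g1 g2 g3; split=> //; rewrite geq_min kT orbT.
  case: bP => [v bv _|no_cand]; rewrite ?ltn_ord ?ltnn /=.
  + split=> //=; first by apply: kept_trans ks _; apply: kept_set_row.
    exists (v |: T'); split.
      by move=> u /=; rewrite addr_eq eqxx !inE; case: eqP => //= _; apply: s'T'.
    move=> g1 g2 g3; have [ext le_iT] := gT' g1 g2 g3; split.
      exact: (greedy_step (arc_sym G co) (arc_irr G co) (@arc_twins _ G co) g1 g2).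
    have /andP[/andP[_ vT] _] := bv.
    by rewrite cardsU1 vT; lia.
  + split=> //; exists T'; split=> // g1 g2 g3; have [ext _] := gT' g1 g2 g3.
    (* This case is contradictory: an extension of a set with fewer than [k] vertices contains a
       further vertex, which is free and so a candidate. *)
    have [S [cS _] [TS lS]] := ext.
    have [D0|[v]] := set_0Vmem (S :\: T').
      by have := cardsID T' S; rewrite D0 (setIidPr TS) cards0 cS; lia.
    rewrite !inE => /andP[vT vS].
    have [|u] := @best_candidate_exists _ edge l T' v; first by rewrite /candidate vT lS.
    by rewrite (negPf (no_cand u)).
- split=> //; exists T'; split=> // g1 g2 g3; have [[S optS [TS _]] le_kT] := gT' g1 g2 g3.
  suff -> : T' = S by [].
  apply/eqP; rewrite eqEcard TS; have [<- _] := optS; apply: leq_trans le_kT.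
  by have [-> _] := optS; rewrite leq_min leqnn andbT -(proj1 optS)
    -[leqRHS](card_ord n) max_card.
Qed.

Local Notation lab := (label (twins G)).

Definition good_set (S : {set 'I_n}) :=
  [/\ optimal edge k S,
    forall x y, lab S x = 2 -> lab S y = 2 -> ~~ twins G x y -> edge x y &
    extendable edge k (lab S) [set v | lab S v == 1]].

Definition label_code S := code is_rep (lab S) (enum 'I_n).

Lemma run_attempt s : has_graph G (mem s) -> reg s 0 = n -> reg s 1 = k ->
  reg s 2 = labellings -> reg s 3 < labellings ->
  kept [:: 0; 1] s (run (attempt co) s) /\
  exists T : {set 'I_n}, has_set 1 (mem (run (attempt co) s)) T /\
    forall S, good_set S -> reg s 3 = label_code S -> optimal edge k T.
Proof.
move=> sG n0 k1 w2 c3; rewrite 2!run_Then.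
have [ks1 dec] := run_decode sG n0 w2 c3; set s1 := run decode s in ks1 dec *.
have fr1 y : y \in [:: 0; 1] -> reg s1 y = reg s y.
  rewrite !inE => y01; apply: (run_frame (D := [:: 0; 2]) (L := [:: 1])) => //.
  by rewrite !inE; case/orP: y01 => ->; rewrite ?orbT.
(* The labelling is read off the memory, so that it exists for every number in register 3. *)
pose l v := mem s1 (n * (n + 0) + v).
have s1l : has_row 0 (mem s1) (fun v : 'I_n => l v) by [].
have n1 : reg s1 0 = n by rewrite fr1.
have [ks2 s2T] := run_start n1 s1l; set s2 := run start s1 in ks2 s2T *.
have fr2 y : y \in [:: 0; 1] -> reg s2 y = reg s1 y.
  rewrite !inE => y01; apply: (run_frame (D := [:: 0]) (L := [:: 1])) => //.
  by rewrite !inE; case/orP: y01 => ->; rewrite ?orbT.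
have k2 : reg s2 1 = k by rewrite fr2 // fr1.
have n2 : reg s2 0 = n by rewrite fr2.
have s2G := kept_graph ks2 (kept_graph ks1 sG).
have [ks3 [T [s3T gT]]] := run_greedy s2G n2 k2 (kept_row ks2 (c := 0) isT s1l) s2T.
split.
  apply: kept_trans (kept_trans (s2 := s1) _ _) (_ : kept _ s2 _).
  - by apply: kept_sub ks1 => c; rewrite !inE => ->.
  - by apply: kept_sub ks2 => c; rewrite !inE => ->; rewrite orbT.
  - by apply: kept_sub ks3 => c; rewrite !inE => ->; rewrite orbT.
exists T; split=> // S [optS S_adj S_ext] cS.
have labE : forall v, lab S v = l v.
  have := dec (lab S) (label_tw (twins_equiv G) S) (label_lt3 _ _) cS.
  by move=> H v; rewrite -H.
apply: gT => [x y|x y xy|].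
- by rewrite -!labE; apply: S_adj.
- by rewrite -!labE; apply: label_tw xy; apply: twins_equiv.
- have [S1 optS1 [TS1 lS1]] := S_ext; exists S1 => //; split.
    by apply: subset_trans TS1; apply/subsetP => v; rewrite !inE labE.
  move=> v vS1 vT; rewrite -labE; apply: lS1 => //.
  by move: vT; rewrite !inE labE.
Qed.

Lemma run_record s (T : {set 'I_n}) : has_graph G (mem s) -> reg s 0 = n -> reg s 1 = k ->
  has_set 1 (mem s) T ->
  if (#|T| == k) && (reg s 8 < arcs edge T + 1) then
    [/\ kept [:: 2] s (run (record co) s), reg (run (record co) s) 8 = arcs edge T + 1 &
      has_set 2 (mem (run (record co) s)) T]
  else run (record co) s = s.
Proof.
move=> sG n0 k1 sT; set P := _ && _.
rewrite (run_WhenP (P := P)); last first.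
  apply: eval_And; first by rewrite eval_Eq (eval_Size (T := T) sT) // evalE k1.
  by rewrite !evalE (eval_Arcs co (T := T) sG sT).
case: P => //; rewrite run_Then run_Assign !evalE (eval_Arcs co (T := T) sG sT) //.
set s1 := set_reg s 8 _.
pose Inv i s' := [/\ kept [:: 2] s s', reg s' 0 = n, reg s' 8 = arcs edge T + 1 &
  forall v : 'I_n, v < i -> mem s' (n * (n + 2) + v) = (v \in T)].
have [||i s' [ks n0' b8 row]|s' [ks n0' b8 row] ->] :=
  run_ForP (Inv := Inv) (n := n) (x := 4) (b := 0)
  (p := StoreRow 2 4 (Row 1 4)) (s := s1).
- by [].
- by [].
- rewrite run_StoreRow mem_set_reg.
  rewrite (eval_has_row (v := i) (kept_row ks (c := 1) isT sT)) //= n0'.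
  split=> //=.
    by apply: kept_trans ks _; apply: kept_set_row.
  move=> v; rewrite addr_eq eqxx ltnS leq_eqVlt val_eqE /=.
  by case: eqVneq => [->|_] //=; apply: row.
- by split=> // v; apply: row.
Qed.

Lemma label_code_lt S : label_code S < labellings.
Proof.
rewrite labellingsE; apply: code_lt; exact: label_lt3.
Qed.

(** Soundness does not depend on the labels: a set is recorded only if it has [k] vertices, along
    with its own arc count. Completeness needs a single labelling, that of a good set. *)
Lemma run_search s : has_graph G (mem s) -> reg s 0 = n -> reg s 1 = k ->
  reg s 2 = labellings -> reg s 8 = 0 ->
  let s' := run (search co) s in
  (reg s' 8 = 0 \/ exists T : {set 'I_n}, [/\ #|T| = k, has_set 2 (mem s') T &
     reg s' 8 = arcs edge T + 1]) /\
  forall S : {set 'I_n}, #|S| = k -> arcs edge S < reg s' 8.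
Proof.
move=> sG n0 k1 w2 b8 s'; rewrite /s' /search {s'}.
pose Inv c s' := [/\ has_graph G (mem s'),
  [/\ reg s' 0 = n, reg s' 1 = k & reg s' 2 = labellings],
  reg s' 8 = 0 \/ (exists T : {set 'I_n}, [/\ #|T| = k, has_set 2 (mem s') T &
     reg s' 8 = arcs edge T + 1]) &
  forall S, good_set S -> label_code S < c -> arcs edge S < reg s' 8].
have [||c s0 [s0G [n0' k1' w2'] best0 max0]|s' [_ _ best max] ->] := run_ForP (Inv := Inv)
    (n := labellings) (x := 3) (b := 2) (p := Then (attempt co) (record co)) (s := s).
- by [].
- by split=> //; left.
- rewrite run_Then.
  have [|||||ks1 [T [s1T gT]]] := run_attempt (s := set_reg s0 3 c) => //;
    first exact: ltn_ord.
  set s1 := run _ _ in ks1 s1T *.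
  have fr1 y : y \in [:: 0; 1; 2; 8] -> reg s1 y = reg s0 y.
    move=> y018; rewrite (run_frame _ (wf_attempt co)).
      by move: y018; rewrite !inE /=; case: (y =P 3) => // ->.
    by move: y018; rewrite !inE => /or4P[] ->; rewrite ?orbT.
  have s1G := kept_graph ks1 s0G.
  have n1 : reg s1 0 = n by rewrite fr1.
  have k1s : reg s1 1 = k by rewrite fr1.
  have := run_record s1G n1 k1s s1T.
  set s2 := run (record co) s1.
  have n2 : reg s2 0 = n.
    by rewrite -n1; apply: (run_frame (D := [:: 0]) (L := [:: 1; 2])) => //; case: (co).
  have k2 : reg s2 1 = k.
    by rewrite -k1s; apply: (run_frame (D := [:: 0]) (L := [:: 1; 2])) => //; case: (co).
  have w2s : reg s2 2 = labellings.
    by rewrite -w2' -fr1 //;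
       apply: (run_frame (D := [:: 0]) (L := [:: 1; 2])) => //; case: (co).
  (* A good set either had its code tried earlier, or its code is [c] and the present attempt
     produced an optimal set. *)
  have opt_max S : good_set S -> label_code S < c.+1 ->
      arcs edge S < reg s1 8 \/ optimal edge k T /\ #|S| = k.
    move=> gS; rewrite ltnS leq_eqVlt => /orP[/eqP cS|lt_c].
      by right; split; [exact: gT gS (esym cS)|case: gS => -[]].
    by left; rewrite fr1 // max0.
  case: ifPn => [/andP[/eqP cT lt8] [ks2 b2 s2T]|noT s2E].
  + split=> //; first exact: kept_graph ks2 s1G.
      by right; exists T.
    move=> S gS /(opt_max S gS)[lt_S|[[_ maxT] cS]]; rewrite b2.
      exact: ltn_trans lt8.
    by rewrite addn1 ltnS maxT.
  + rewrite s2E in n2 k2 w2s *; split=> //.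
      rewrite fr1 //; case: best0 => [|[T0 [cT0 s0T0 b0]]];
        [by left|right; exists T0; split=> //].
      exact: (kept_row ks1 (c := 2)).
    move=> S gS /(opt_max S gS)[lt_S|[[cT maxT] cS]] //.
    move: noT; rewrite cT eqxx /= -leqNgt addn1; apply: leq_trans.
    by rewrite ltnS maxT.
(* As [S] shows [k <= n], [greedy_start] supplies a good set; its code has been tried, and it has at
   least as many arcs as [S]. *)
- split=> // S cS.
  have kn : k <= #|'I_n| by rewrite -cS max_card.
  have [S0 [optS0 adjS0 extS0]] := greedy_start (arc_sym G co) (arc_irr G co)
    (twins_equiv G) (@arc_twins _ G co) kn.
  apply: leq_ltn_trans (max S0 _ (label_code_lt S0)); last by split.
  by have [_ H] := optS0; apply: H.
Qed.

Lemma run_output s (T : {set 'I_n}) : reg s 0 = n -> has_set 2 (mem s) T ->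
  forall v : 'I_n, mem (run output s) v = (v \in T).
Proof.
move=> n0 sT; pose Inv i s' := [/\ reg s' 0 = n, has_set 2 (mem s') T &
  forall v : 'I_n, v < i -> mem s' v = (v \in T)].
have [||i s' [n0' row2 row]|s' [n0' row2 row] ->] :=
  run_ForP (Inv := Inv) (n := n) (x := 4) (b := 0)
  (p := Store (Var 4) (Row 2 4)) (s := s).
- by [].
- by [].
- rewrite /run -/run mem_set_reg (eval_has_row (v := i) row2) // evalE /=.
  (* The output overwrites row 0 of the adjacency matrix, which is no longer read, and misses row
     [n + 2]. *)
  have E c (v : 'I_n) : (n * c + v == i) = (c == 0) && (v == i).
    by rewrite -(addr_eq _ 0 _ i) muln0 add0n.
  split=> //= v; first by rewrite E; have := row2 v; rewrite addn2.
  have := E 0 v; rewrite muln0 add0n => ->.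
  rewrite ltnS leq_eqVlt val_eqE /=.
  by case: eqVneq => [->|_] //=; apply: row.
- by move=> v; apply: row.
Qed.
End Runs.

(** * Correctness and cost of the whole program *)

Lemma labellings_nd n (G : sgraph 'I_n) : labellings G <= 3 ^ nd G.
Proof.
rewrite leq_exp2l // -(cardsE (is_rep G)); apply: card_nontwins_le_nd => u v.
rewrite !inE => /forall_inP ru /forall_inP rv uv; apply: val_inj.
case: (ltngtP u v) => // [/rv|/ru]; first by rewrite uv.
by rewrite twins_sym uv.
Qed.

Lemma has_graph_input n (G : sgraph 'I_n) k : has_graph G (mem (input G k)).
Proof.
move=> u v /=; congr nat_of_bool; apply/existsP/idP => [[x /existsP[y /andP[E]]]|uv].
  by rewrite ![_ * n]mulnC addr_eq in E; case/andP: E => /eqP/val_inj-> /eqP->.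
by exists u; apply/existsP; exists v; rewrite mulnC eqxx.
Qed.

Lemma program_correct co : exists K c, forall n (G : sgraph 'I_n) k, exists t s',
  [/\ exec (program co) (input G k) t s',
      t <= K * 3 ^ (c * nd G) * maxn 1 n ^ c &
      correct_output (optimal (arc G co) k) s'].
Proof.
have [K [c costP]] : poly_bounded (fun M => cost M count_labellings +
    (cost M (search co) + (cost M output + cost M verdict))).
  by do 3![apply: poly_add; first exact: poly_cost]; exact: poly_cost.
(* The product is positive, bounds both loop bounds [n] and [labellings G], and its powers split
   into a factor in [nd G] and one in [n]. *)
exists K, c => n G k; pose M := maxn 1 n * 3 ^ nd G.
pose s0 := input G k.
have leM : n <= M /\ labellings G <= M.
  have := labellings_nd G; have : 0 < 3 ^ nd G by rewrite expn_gt0.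
  rewrite /M; move: (3 ^ nd G) => x; split; nia.
have [m1 w1] := run_count (has_graph_input G k) (erefl : reg s0 0 = n).
set s1 := run count_labellings s0 in m1 w1.
have fr1 y : y \in [:: 0; 1; 8] -> reg s1 y = reg s0 y.
  by rewrite !inE => y_; rewrite (run_frame _ wf_count) // !inE.
have s1G : has_graph G (mem s1) by rewrite m1; apply: has_graph_input.
have n1 : reg s1 0 = n by rewrite fr1.
have k1 : reg s1 1 = k by rewrite fr1.
have b1 : reg s1 8 = 0 by rewrite fr1.
have [best max] := run_search co s1G n1 k1 w1 b1; set s2 := run (search co) s1 in best max.
have n2 : reg s2 0 = n by rewrite (run_frame _ (wf_search co)).
set s3 := run output s2.
have b3 : reg s3 8 = reg s2 8 by rewrite (run_frame _ wf_output).
have r4 : reg (run verdict s3) 0 = (0 < reg s2 8) by rewrite run_Assign eval_Lt -b3.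
have real : realizes (program co) s0 (cost M count_labellings +
    (cost M (search co) + (cost M output + cost M verdict))) (run verdict s3).
  apply: realizes_seq; first apply: (compP wf_count).
    by move=> b; rewrite inE => /eqP ->; apply: (proj1 leM).
  apply: realizes_seq; first apply: (compP (wf_search co)).
    by move=> b; rewrite !inE => /orP[]/eqP->; rewrite ?n1 ?w1; apply leM.
  apply: realizes_seq; first apply: (compP wf_output).
    by move=> b; rewrite inE => /eqP ->; rewrite n2; apply leM.
  exact: (compP wf_verdict).
have [t [s' [xs le_t [fr fm]]]] := real s0 (conj (fun _ _ => erefl) (fun _ => erefl)).
exists t, s'; split=> //.
  have M0 : 0 < M by rewrite muln_gt0 expn_gt0 leq_max.
  apply: leq_trans le_t (leq_trans (costP M M0) _).
  by rewrite /M expnMn -expnM -mulnA (mulnC (nd G)) [X in K * X]mulnC.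
rewrite /correct_output fr // r4.
case: best => [b2|[T [cT s2T b2]]].
  by right; rewrite b2; split=> // S [cS _]; have := max S cS; rewrite b2.
left; rewrite b2 addn1; split=> //; exists T.
  by split=> // S /max; rewrite b2 addn1.
by move=> v; rewrite fm mem_set_reg; apply: run_output.
Qed.

Lemma densest_optimal (V : finType) (G : sgraph V) k S :
  densest_k_subgraph G k S <-> optimal (arc G false) k S.
Proof.
by split=> -[cS maxS]; split=> // S' /maxS; rewrite !arcs_adj leq_double.
Qed.

Lemma sparsest_optimal (V : finType) (G : sgraph V) k S :
  sparsest_k_subgraph G k S <-> optimal (arc G true) k S.
Proof.
split=> -[cS maxS]; split=> // S' cS'; have := maxS S' cS';
  have := arcs_co G S; have := arcs_co G S'; rewrite !arcs_adj cS cS'; lia.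
Qed.

Lemma correct_output_ext n (sol sol' : {set 'I_n} -> Prop) s :
  (forall S, sol' S <-> sol S) -> correct_output sol s -> correct_output sol' s.
Proof.
move=> E [[r1 [S solS mS]]|[r0 nosol]]; [left|right]; split=> //.
  by exists S => //; apply/E.
by move=> S /E; apply: nosol.
Qed.

(** * Running time *)

(** The [e] triplings are unrolled; the assignment to the spare register 2 serves as an empty
    statement. *)
Definition power_body (e : nat) : stmt :=
  iter e (Then (Assign 1 (Plus (Var 1) (Plus (Var 1) (Var 1))))) (Assign 2 (Num 0)).

Lemma run_power_body e s : reg (run (power_body e) s) 1 = 3 ^ e * reg s 1 /\
  reg (run (power_body e) s) 0 = reg s 0.
Proof.
elim: e s => [|e IH] s; first by rewrite mul1n.
rewrite /power_body iterS run_Then -/(power_body e).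
have [-> ->] := IH (run (Assign 1 (Plus (Var 1) (Plus (Var 1) (Var 1)))) s).
by rewrite run_Assign !evalE /=; split=> //; rewrite expnS; lia.
Qed.

Lemma wf_power_body e : wf [:: 0] [:: 3] (power_body e).
Proof. by elim: e. Qed.

Lemma computable_power K e : computable (fun d => K * 3 ^ (e * d)).
Proof.
pose p := Then (Assign 1 (Num K)) (For 3 0 (power_body e)).
exists (Seq (comp p) (comp (Assign 0 (Var 1)))) => d.
set s0 := State _ _.
have wfp : wf [:: 0] [::] p by rewrite /= wf_power_body.
have real : realizes (Seq (comp p) (comp (Assign 0 (Var 1)))) s0
    (cost d p + cost d (Assign 0 (Var 1))) (run (Assign 0 (Var 1)) (run p s0)).
  apply: realizes_seq; first by apply: (compP wfp) => b; rewrite inE => /eqP ->.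
  exact: (compP (D := [::]) (L := [::])).
have [t [s' [xs _ [fr _]]]] := real s0 (conj (fun _ _ => erefl) (fun _ => erefl)).
exists t, s'; split=> //; rewrite fr // run_Assign evalE /p run_Then run_Assign.
pose Inv i s := reg s 1 = K * 3 ^ (e * i) /\ reg s 0 = d.
have [||i s [v r0]|s [v r0] ->] := run_ForP (Inv := Inv) (n := d) (x := 3) (b := 0)
  (p := power_body e) (s := set_reg s0 1 (eval (mem s0) (reg s0) (Num K))).
- by [].
- by rewrite /Inv muln0 muln1.
- rewrite /Inv; have [-> ->] := run_power_body e (set_reg s 3 i); rewrite /= v.
  by rewrite mulnS expnD mulnCA.
- by [].
Qed.

Theorem theorem1 :
  exists f : nat -> nat, computable f /\
    solvable_in_fpt_nd_time f densest_k_subgraph /\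
    solvable_in_fpt_nd_time f sparsest_k_subgraph.
Proof.
have [K1 [c1 P1]] := program_correct false.
have [K2 [c2 P2]] := program_correct true.
(* Adding the constants and the exponents gives one bound that dominates both running times. *)
exists (fun d => (K1 + K2) * 3 ^ ((c1 + c2) * d)); split; first exact: computable_power.
have le_bound K c n d : K <= K1 + K2 -> c <= c1 + c2 ->
    K * 3 ^ (c * d) * maxn 1 n ^ c <=
    (K1 + K2) * 3 ^ ((c1 + c2) * d) * maxn 1 n ^ (c1 + c2).
  move=> leK lec; rewrite !leq_mul // leq_pexp2l ?leq_maxl //.
  by rewrite leq_mul.
split; [exists (program false), (c1 + c2)|exists (program true), (c1 + c2)] => n G k.
- have [t [s' [xs le_t out]]] := P1 n G k; exists t, s'; split=> //.
    by apply: leq_trans le_t _; apply: le_bound; apply: leq_addr.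
  by apply: correct_output_ext out => S; apply: densest_optimal.
- have [t [s' [xs le_t out]]] := P2 n G k; exists t, s'; split=> //.
    by apply: leq_trans le_t _; apply: le_bound; apply: leq_addl.
  by apply: correct_output_ext out => S; apply: sparsest_optimal.
Qed.
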